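(* Let $E\subset\mathfrak p$ be a $K$-invariant convex body, let $\mathfrak a\subset\mathfrak p$ be a maximal abelian subalgebra, and let $P=E\cap\mathfrak a$. Then the map $$\mathscr F(P)\to\mathscr F(E),\qquad \sigma\mapsto K^{\sigma^\perp}\cdot\sigma$$ is well-defined (i.e. $K^{\sigma^\perp}\cdot\sigma$ is a face of $E$ for every face $\sigma$ of $P$) and induces a bijection between $\mathscr F(P)/\mathcal N_K(\mathfrak a)$ and $\mathscr F(E)/K$.
   Context: Setting: $\mathfrak g$ is a real semisimple Lie algebra with Cartan involution $\theta$ and Cartan decomposition $\mathfrak g=\mathfrak k\oplus\mathfrak p$ ($+1$ and $-1$ eigenspaces of $\theta$). $G$ is a connected real semisimple Lie group with Lie algebra $\mathfrak g$, and $K\subset G$ is a maximal compact subgroup with Lie algebra $\mathfrak k$. $K$ acts on $\mathfrak p$ by the adjoint representation, $k\cdot x=\mathrm{Ad}(k)(x)$, and $\langle\cdot,\cdot\rangle$ is the $K$-invariant scalar product on $\mathfrak p$ given by the restriction of the Killing form. Notation: a convex body is a (nonempty) compact convex set. A face of a convex body $C$ is a convex subset $F\subset C$ such that $x,y\in C$ and $\mathrm{relint}[x,y]\cap F\neq\emptyset$ imply $[x,y]\subset F$; here faces are taken nonempty, and $C$ itself is a face. $\mathscr F(C)$ is the set of faces of $C$. For a subset $B\subset\mathfrak p$, $K^B=\{k\in K: \mathrm{Ad}(k)\xi=\xi \text{ for all }\xi\in B\}$. $\mathcal N_K(\mathfrak a)=\{h\in K:\mathrm{Ad}(h)(\mathfrak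 a)=\mathfrak a\}$; it acts on $P$, hence on $\mathscr F(P)$, and $K$ acts on $\mathscr F(E)$. For a face $\sigma$ of $P$, the direction $\mathrm{Dir}(\sigma)$ is the linear subspace of $\mathfrak a$ with $\mathrm{Aff}(\sigma)=p+\mathrm{Dir}(\sigma)$, where $\mathrm{Aff}$ is the affine hull, and $\sigma^\perp$ is the orthogonal complement of $\mathrm{Dir}(\sigma)$ in $\mathfrak a$. *)

(* Defs.v *)
From HB Require Import structures.
From mathcomp Require Import all_boot all_order all_algebra.
From mathcomp Require Import all_classical all_reals all_analysis.

Set Implicit Arguments.
Unset Strict Implicit.
Unset Printing Implicit Defensive.

Import Order.TTheory GRing.Theory Num.Theory.
Import numFieldNormedType.Exports.

Local Open Scope classical_set_scope.
Local Open Scope ring_scope.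

(** * Lie algebras *)

HB.mixin Record isLieAlgebra (R : realType) g & Vector R g := {
  lie : g -> g -> g;
  lie_linearl : forall y, linear (fun x => lie x y);
  lie_linearr : forall x, linear (lie x);
  liexx : forall x, lie x x = 0;
  lie_jacobi : forall x y z,
    lie x (lie y z) + lie y (lie z x) + lie z (lie x y) = 0
}.

#[short(type="lieAlgType")]
HB.structure Definition LieAlgebra (R : realType) :=
  { g of Vector R g & isLieAlgebra R g }.

Section LieAlgebraTheory.
Variables (R : realType) (g : lieAlgType R).
Implicit Types (x y : g) (U I : {vspace g}) (theta : 'End(g)).

HB.instance Definition _ x := GRing.isSemilinear.Build R g g _ (@lie R g x)
  (GRing.semilinear_linear (@lie_linearr R g x)).

Definition ad x : 'End(g) := linfun (lie x).

Definition killing x y : R :=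
  \tr (passmx.mxof (vbasis {:g}) (vbasis {:g}) (ad x \o ad y)%VF).

Definition lie_ideal I := forall x y, y \in I -> lie x y \in I.

Definition derived U : {vspace g} :=
  <<[seq lie x y | x <- vbasis U, y <- vbasis U]>>%VS.

Definition lie_solvable U := exists m, iter m derived U = 0%VS.

Definition semisimple :=
  forall I, lie_ideal I -> lie_solvable I -> I = 0%VS.

Definition lie_abelian U := {in U &, forall x y, lie x y = 0}.

Definition cartan_involution theta :=
  [/\ forall x y, theta (lie x y) = lie (theta x) (theta y),
      forall x, theta (theta x) = x &
      forall x, x != 0 -> 0 < - killing x (theta x)].

Definition cartan_k theta : {vspace g} := passmx.leigenspace theta 1.
Definition cartan_p theta : {vspace g} := passmx.leigenspace theta (-1).

(* Maximal among the abelian subspaces of p; an abelian subspace is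
   automatically a subalgebra. *)
Definition maximal_abelian theta (a : {vspace g}) :=
  [/\ (a <= cartan_p theta)%VS, lie_abelian a &
      forall b : {vspace g}, (b <= cartan_p theta)%VS -> lie_abelian b ->
        (a <= b)%VS -> b = a].

End LieAlgebraTheory.

(** * Lie groups *)

Fixpoint cont_diff (R : realType) (V W : normedModType R) (m : nat)
    (U : set V) (f : V -> W) : Prop :=
  match m with
  | 0 => forall x, U x -> {for x, continuous f}
  | m'.+1 => (forall x, U x -> differentiable f x) /\
             forall v, cont_diff m' U (fun x => 'd f x v)
  end.

Definition smooth_on (R : realType) (V W : normedModType R)
  (U : set V) (f : V -> W) := forall m, cont_diff m U f.

(* [cfun] and [cinv] are total; only their values on [cdom] and [cran c]
   are meaningful. *)
Record chart (R : realType) (n : nat) (M : topologicalType) := Chart {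
  cdom : set M;
  cfun :> M -> 'rV[R]_n;
  cinv : 'rV[R]_n -> M
}.

Definition cran R n M (c : @chart R n M) : set 'rV[R]_n := c @` cdom c.

Definition is_chart R n M (c : @chart R n M) :=
  [/\ open (cdom c), open (cran c),
      {within cdom c, continuous c},
      {within cran c, continuous (cinv c)} &
      forall x, cdom c x -> cinv c (c x) = x].

Definition smooth_atlas R n M (A : set (@chart R n M)) :=
  [/\ forall c, A c -> is_chart c,
      forall x, exists2 c, A c & cdom c x &
      forall c d, A c -> A d ->
        smooth_on (c @` (cdom c `&` cdom d)) (d \o cinv c)].

HB.mixin Record isLieGroup (R : realType) (n : nat) G
    & Group G & Topological G := {
  lie_hausdorff : hausdorff_space G;
  lie_second_countable : @second_countable G;
  atlas : set (chart R n G);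
  atlas_smooth : smooth_atlas atlas;
  lie_mul_continuous : continuous (fun xy : G * G => (xy.1 * xy.2)%g);
  lie_inv_continuous : continuous (fun x : G => (x^-1)%g);
  lie_mul_smooth : forall c1 c2 d, atlas c1 -> atlas c2 -> atlas d ->
    smooth_on
      [set uv : 'rV[R]_n * 'rV[R]_n | [/\ cran c1 uv.1, cran c2 uv.2 &
        cdom d (cinv c1 uv.1 * cinv c2 uv.2)%g]]
      (fun uv => d (cinv c1 uv.1 * cinv c2 uv.2)%g);
  lie_inv_smooth : forall c d, atlas c -> atlas d ->
    smooth_on [set u | cran c u /\ cdom d ((cinv c u)^-1)%g]
      (fun u => d ((cinv c u)^-1)%g)
}.

#[short(type="lieGroupType")]
HB.structure Definition LieGroup (R : realType) (n : nat) :=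
  { G of Group G & Topological G & isLieGroup R n G }.

(* A chart [c] around the identity identifies the tangent space at the identity
   with R^n. In these coordinates [chart_Ad c h] is the differential at the
   identity of the conjugation x |-> h x h^-1, and the Lie bracket is
   [X, Y] = ad(X) Y with ad the differential of Ad at the identity. *)
Section ChartAd.
Variables (R : realType) (n : nat) (G : lieGroupType R n) (c : chart R n G).

Definition chart_Ad (h : G) : 'rV[R]_n -> 'rV[R]_n :=
  'd (fun u => c (h * cinv c u * h^-1)%g) (c 1%g).

Definition chart_bracket (X Y : 'rV[R]_n) : 'rV[R]_n :=
  'D_X (fun u => chart_Ad (cinv c u) Y) (c 1%g).

End ChartAd.

(* "G has Lie algebra g": an isomorphism of Lie algebras between g and the
   tangent space of G at the identity, the latter read in the chart
   [id_chart]. *)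
Record has_lie_algebra (R : realType) (n : nat) (G : lieGroupType R n)
    (g : lieAlgType R) := HasLieAlgebra {
  id_chart : chart R n G;
  id_chart_atlas : atlas id_chart;
  id_chart_dom : cdom id_chart 1%g;
  to_tangent : 'Hom(g, 'rV[R]_n);
  to_tangent_bij : bijective to_tangent;
  to_tangent_lie : forall x y : g, to_tangent (lie x y) =
    chart_bracket id_chart (to_tangent x) (to_tangent y)
}.

Section AdjointRepresentation.
Variables (R : realType) (n : nat) (G : lieGroupType R n) (g : lieAlgType R).
Variable L : has_lie_algebra G g.
Implicit Types (H K : set G) (B sigma : set g).

Definition Ad (h : G) (x : g) : g :=
  (to_tangent L)^-1%VF (chart_Ad (id_chart L) h (to_tangent L x)).

Definition subgroup K :=
  K 1%g /\ forall x y, K x -> K y -> K (x * y^-1)%g.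

Definition maximal_compact_subgroup K :=
  [/\ subgroup K, compact K &
      forall H, subgroup H -> compact H -> K `<=` H -> H = K].

(* The Lie algebra of a closed subgroup: the x such that exp(t x) lies in K
   for all t, where t |-> exp(t x) is the one-parameter subgroup with
   velocity x at 0. *)
Definition subgroup_lie_algebra K : set g :=
  [set x | exists gam : R -> G,
    [/\ continuous gam,
        forall s t, gam (s + t) = (gam s * gam t)%g,
        is_derive (0 : R) (1 : R) (id_chart L \o gam) (to_tangent L x) &
        forall t, K (gam t)]].

Definition Ad_invariant K B := forall k x, K k -> B x -> B (Ad k x).

Definition pointwise_stabilizer K B : set G :=
  [set k | K k /\ forall xi, B xi -> Ad k xi = xi].

Definition normalizer K (a : {vspace g}) : set G :=
  [set h | K h /\ Ad h @` [set` a] = [set` a]].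

Definition Ad_orbit H sigma : set (set g) :=
  [set Ad h @` sigma | h in H].

Definition orbit_space H (F : set (set g)) : set (set (set g)) :=
  [set Ad_orbit H sigma | sigma in F].

End AdjointRepresentation.

(** * Convex geometry *)

Section Convex.
Variables (R : realType) (V : vectType R).
Implicit Types (A C F : set V) (x y v : V).

(* Compactness for the canonical topology of a finite-dimensional space,
   read in coordinates in a basis. *)
Definition vect_compact A := compact (passmx.rVof (vbasis {:V}) @` A).

Definition convex_body C :=
  [/\ C !=set0, @convex_set R V C & vect_compact C].

Definition seg x y : set V :=
  [set (1 - t) *: x + t *: y | t in [set t : R | 0 <= t <= 1]].

(* This is [set x] when x = y, in accordance with relint [x, x] = {x}. *)
Definition relint_seg x y : set V :=
  [set (1 - t) *: x + t *: y | t in [set t : R | 0 < t < 1]].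

Definition is_face C F :=
  [/\ F !=set0, F `<=` C, @convex_set R V F &
      forall x y, C x -> C y -> relint_seg x y `&` F !=set0 ->
        seg x y `<=` F].

Definition faces C : set (set V) := [set F | is_face C F].

Definition aff_hull A : set V :=
  [set v | exists m (x : 'I_m -> V) (t : 'I_m -> R),
    [/\ forall i, A (x i), \sum_i t i = 1 & v = \sum_i t i *: x i]].

(* For nonempty A and any p in aff_hull A, aff_hull A = p + Dir A. *)
Definition Dir A : set V :=
  [set v | exists x y, [/\ aff_hull A x, aff_hull A y & v = x - y]].

End Convex.

Section FaceMap.
Variables (R : realType) (n : nat) (G : lieGroupType R n) (g : lieAlgType R).
Variables (L : has_lie_algebra G g) (K : set G) (a : {vspace g}).

Definition perp (sigma : set g) : set g :=
  [set x | x \in a /\ forall v, Dir sigma v -> killing x v = 0].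

Definition face_map (sigma : set g) : set g :=
  [set Ad L k x | k in pointwise_stabilizer L K (perp sigma) & x in sigma].

End FaceMap.

(* Main.v *)
Require Import Defs.
From HB Require Import structures.
From mathcomp Require Import all_boot all_order all_algebra.
From mathcomp Require Import all_classical all_reals all_analysis.
From mathcomp Require Import ring lra.

Set Implicit Arguments.
Unset Strict Implicit.
Unset Printing Implicit Defensive.

Import Order.TTheory GRing.Theory Num.Theory.
Import numFieldNormedType.Exports.

Local Open Scope classical_set_scope.
Local Open Scope ring_scope.

(** Write [P] for the section of the body [E] by the maximal abelian subspace
    [a], and, for a set [B] of vectors, call stabiliser of [B] the subgroup of [K]
    that fixes [B] pointwise.

    Everything rests on one variational principle, [commute_of_max]. Let [y] and
    [h] be vectors of the p-part that commute with [B], and suppose that [y]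
    maximises the height [killing h] on its orbit under the stabiliser of [B].
    Then [lie y h = 0]: this bracket [w] lies in the k-part and commutes with [B],
    so it generates a one-parameter group inside the stabiliser, and along this
    group the height has derivative [killing w w], which is negative unless [w]
    vanishes. The principle uses the Lie group only through the following facts:
    [Ad] is a continuous action by Lie algebra automorphisms, and the elements of
    the k-part generate one-parameter groups in [K]. They are extracted from the
    charts by the chain rule.

    Since stabilisers are compact, heights do attain their maximum on orbits.
    Maximising successively against a basis of [a] moves any [y] that commutes
    with a subset [B] of [a] into [a] by an element of the stabiliser of [B]
    ([conj_into_abelian]), and likewise any finite commuting family
    ([conj_seq_into_abelian]).

    Let [F] be a slice, that is, a convex body that commutes with [B] and is
    invariant under the stabiliser of [B]; [E] itself is the case where [B] is
    zero. Heights of points of [a] attain their maximum over [F] inside [a]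
    ([slice_max]). If [B] is orthogonal to the directions of the section of [F],
    it follows that [F] commutes with the orthogonal of these directions, whence
    [F] is the image of its section under the face map ([slice_face_map]). Now let
    [sigma] be a face of the section of [F]. If it is not the whole section, it
    lies in a supporting hyperplane of the section, with normal [h] in [a]; the
    points of [F] of maximal height form an exposed face of [F], which is a slice
    for the larger space spanned by [B] and [h]. Induction on the codimension of
    [B] in [a] shows that the face map sends [sigma] to a face ([slice_face]).

    For the bijection, faces are described by points: every face is the smallest
    face containing one of its relatively interior points. The face map sends the
    smallest face of [P] at [x] to the smallest face of [E] at [x]
    ([face_map_min_face]). Surjectivity follows by moving a relatively interior
    point of a face of [E] into [a]. Injectivity reduces to the fact that two
    points of [a] conjugate under [K] are conjugate under the normalizer of [a]
    ([conj_normalizer]). *)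
(** * Differentials and charts *)

Section Differentials.
Variable R : realType.

Lemma near_eq_diff (V W : normedModType R) (f f' : V -> W) (x : V) :
  (\near x, f x = f' x) -> differentiable f x ->
  differentiable f' x /\ 'd f' x = 'd f x :> (V -> W).
Proof.
move=> ff' df.
have fx : f x = f' x by exact: nbhs_singleton ff'.
have key : f' \o shift x = cst (f' x) + 'd f x +o_ 0 id.
  apply/eqaddoP => _/posnumP[eps].
  have /eqaddoP/(_ eps%:num (gt0 eps)) := diff_locally df.
  have ff'0 : \forall y \near (0 : V), f (y + x) = f' (y + x).
    by have := ff'; rewrite (near_shift 0) subr0.
  apply: filterS2 ff'0 => y /= yE.
  by rewrite /= !fctE /= -yE -fx.
have dE := diff_unique (diff_continuous df) key.
split=> //; apply/diff_locallyP; rewrite dE; split=> //.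
exact: diff_continuous.
Qed.

Lemma differentiable_rV (V : normedModType R) n (F : V -> 'rV[R]_n) x :
  (forall j, differentiable (fun u => F u 0 j) x) -> differentiable F x.
Proof.
move=> dF.
have -> : F = \sum_(j < n) (fun u => F u 0 j *: (delta_mx 0 j : 'rV[R]_n)).
  by apply/funext => u; rewrite fct_sumE [LHS]row_sum_delta.
by apply: differentiable_sum => j; exact: differentiableZl.
Qed.

(** A map linear in its second argument is a finite combination of its values on
    the standard basis, with the coordinates of the vector as coefficients. *)
Lemma differentiable_eval (V : normedModType R) n m
    (A : V -> 'rV[R]_n -> 'rV[R]_m) (F : V -> 'rV[R]_n) x :
  (forall u, linear (A u)) -> (forall v, differentiable (A^~ v) x) ->
  differentiable F x -> differentiable (fun u => A u (F u)) x.
Proof.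
move=> linA dA dF; apply: differentiable_rV => k.
have -> : (fun u => A u (F u) 0 k) =
   \sum_(j < n) ((fun u => F u 0 j) * (fun u => A u (delta_mx 0 j) 0 k)).
  apply/funext => u; rewrite fct_sumE.
  pose Al := GRing.isLinear.Build _ _ _ _ _ (linA u).
  pose AL : {linear _ -> _} := HB.pack (A u) Al.
  rewrite {1}[F u]row_sum_delta -[A u]/(AL : _ -> _) linear_sum summxE.
  by apply: eq_bigr => j _; rewrite linearZ mxE.
apply: differentiable_sum => j; apply: differentiableM.
  exact: (differentiable_comp dF (differentiable_coord _ _ _)).
exact: (differentiable_comp (dA _) (differentiable_coord _ _ _)).
Qed.

Lemma is_diff_pair1 (V W : normedModType R) (a : V) (x : W) :
  is_diff x (fun w => (a, w)) (fun w => (0, w)).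
Proof.
have da : differentiable (cst a : W -> V) x by exact: differentiable_cst.
have di : differentiable (id : W -> W) x by [].
apply: DiffDef; first exact: (differentiable_pair da di).
by apply: etrans (diff_pair da di) _; rewrite diff_cst diff_val.
Qed.

Lemma is_diff_pair2 (V W : normedModType R) (a : V) (x : W) :
  is_diff x (fun w => (w, a)) (fun w => (w, 0)).
Proof.
have da : differentiable (cst a : W -> V) x by exact: differentiable_cst.
have di : differentiable (id : W -> W) x by [].
apply: DiffDef; first exact: (differentiable_pair di da).
by apply: etrans (diff_pair di da) _; rewrite diff_cst diff_val.
Qed.

Lemma linear_rV_differentiable n (F : {linear 'rV[R]_n -> R^o}) v :
  differentiable (F : _ -> R) v.
Proof.
have -> : (F : _ -> _) = \sum_(j < n) (fun w : 'rV[R]_n => w 0 j *: F (delta_mx 0 j)).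
  apply/funext => u; rewrite fct_sumE {1}[u]row_sum_delta linear_sum.
  by apply: eq_bigr => j _; rewrite linearZ.
apply: differentiable_sum => j; apply: differentiableZl.
exact: differentiable_coord.
Qed.

End Differentials.

Section Charts.
Variables (R : realType) (n : nat) (G : lieGroupType R n).
Implicit Types (c d f : chart R n G) (h k x : G).

Lemma atlas_chart c : atlas c -> is_chart c.
Proof. by have [+ _ _] := @atlas_smooth R n G; apply. Qed.

Lemma exists_chart x : exists2 c, atlas c & cdom c x.
Proof. by have [_ + _] := @atlas_smooth R n G; apply. Qed.

Lemma chartK c x : atlas c -> cdom c x -> cinv c (c x) = x.
Proof. by move=> /atlas_chart[_ _ _ _]; apply. Qed.

Lemma cran_chart c x : cdom c x -> cran c (c x).
Proof. by move=> cx; exists x. Qed.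

Lemma cdom_cinv c u : atlas c -> cran c u -> cdom c (cinv c u).
Proof. by move=> ac [x cx <-]; rewrite chartK. Qed.

Lemma cinvK c u : atlas c -> cran c u -> c (cinv c u) = u.
Proof. by move=> ac [x cx <-]; rewrite chartK. Qed.

Lemma near_cdom c x : atlas c -> cdom c x -> \forall y \near x, cdom c y.
Proof. by move=> /atlas_chart[oc _ _ _ _] cx; apply: open_nbhs_nbhs. Qed.

Lemma near_cran c u : atlas c -> cran c u -> \forall v \near u, cran c v.
Proof. by move=> /atlas_chart[_ oc _ _ _] cx; apply: open_nbhs_nbhs. Qed.

Lemma chart_continuous c x : atlas c -> cdom c x -> {for x, continuous c}.
Proof.
move=> /atlas_chart[oc _ cc _ _] cx.
by move: cc; rewrite continuous_open_subspace// => /(_ x); apply; rewrite inE.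
Qed.

Lemma cinv_continuous c u : atlas c -> cran c u ->
  {for u, continuous (cinv c)}.
Proof.
move=> /atlas_chart[_ oc _ cc _] cx.
by move: cc; rewrite continuous_open_subspace// => /(_ u); apply; rewrite inE.
Qed.

Lemma mulg_cvg (T : Type) (F : set_system T) (FF : Filter F) (p q : T -> G)
  (x y z : G) :
  (x * y)%g = z -> p @ F --> x -> q @ F --> y -> (fun t => (p t * q t)%g) @ F --> z.
Proof.
move=> <- px qy.
apply: (@cvg_comp _ _ _ (fun t => (p t, q t)) (fun z => (z.1 * z.2)%g) F
  (nbhs (x, y))).
  exact: cvg_pair.
exact: (@lie_mul_continuous R n G (x, y)).
Qed.

Lemma mulgl_cvg (T : Type) (F : set_system T) (FF : Filter F) (q : T -> G)
    (h y z : G) :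
  (h * y)%g = z -> q @ F --> y -> (fun t => (h * q t)%g) @ F --> z.
Proof.
move=> yz qy; apply: (@mulg_cvg _ _ _ (fun=> h) _ _ _ _ yz) => //.
exact: cvg_cst.
Qed.

Lemma mulgr_cvg (T : Type) (F : set_system T) (FF : Filter F) (p : T -> G)
    (x h z : G) :
  (x * h)%g = z -> p @ F --> x -> (fun t => (p t * h)%g) @ F --> z.
Proof.
move=> yz qy; apply: (@mulg_cvg _ _ _ _ (fun=> h) _ _ _ yz) => //.
exact: cvg_cst.
Qed.

(** First-order part of the smoothness of multiplication, at a point given by
    group elements rather than by coordinates. *)
Lemma mulg_diff c1 c2 d x y : atlas c1 -> atlas c2 -> atlas d ->
  cdom c1 x -> cdom c2 y -> cdom d (x * y)%g ->
  differentiable (fun uv => d (cinv c1 uv.1 * cinv c2 uv.2)%g) (c1 x, c2 y).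
Proof.
move=> a1 a2 ad x1 y2 xyd.
have [+ _] := lie_mul_smooth _ _ _ a1 a2 ad 1%N; apply.
by split=> /=; rewrite ?chartK//; exact: cran_chart.
Qed.

End Charts.

(** * The adjoint representation read in a chart *)

Section Conjugation.
Variables (R : realType) (n : nat) (G : lieGroupType R n).
Variable c : chart R n G.
Hypotheses (ac : atlas c) (c1 : cdom c 1%g).
Implicit Types (h k x : G) (u v : 'rV[R]_n).

Local Notation e := (c 1%g).

Lemma cvg_cinv1 : cinv c u @[u --> e] --> (1 : G)%g.
Proof.
rewrite -[X in _ --> X](chartK ac c1).
exact: cinv_continuous ac (cran_chart c1).
Qed.

Lemma cvg_lmul1 h : (h * cinv c u)%g @[u --> e] --> h.
Proof. by apply: mulgl_cvg cvg_cinv1; rewrite mulg1. Qed.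

Lemma near_lmul1 d h : atlas d -> cdom d h ->
  \forall u \near e, cdom d (h * cinv c u)%g.
Proof. by move=> ad dh; have /(_ _ (near_cdom ad dh)) := @cvg_lmul1 h. Qed.

Lemma cvg_conj h : (h * cinv c u * h^-1)%g @[u --> e] --> (1 : G)%g.
Proof.
by apply: mulgr_cvg (@cvg_lmul1 h); rewrite mulgV. 
Qed.

Lemma near_conj h : \forall u \near e, cdom c (h * cinv c u * h^-1)%g.
Proof. by have /(_ _ (near_cdom ac c1)) := @cvg_conj h. Qed.

Definition conj_chart h u : 'rV[R]_n := c (h * cinv c u * h^-1)%g.

Lemma chart_AdE h X : chart_Ad c h X = 'd (conj_chart h) e X.
Proof. by []. Qed.

Lemma conj_chart1 h : conj_chart h e = e.
Proof. by rewrite /conj_chart chartK// mulg1 mulgV. Qed.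

(** When [h] is far from the identity, [h * x] leaves the domain of [c]: the
    conjugation is therefore cut into a left translation with values in a chart
    at [h], followed by a right translation that comes back to [c]. *)
Lemma conj_chart_diff h : differentiable (conj_chart h) e.
Proof.
have [d ad dh] := exists_chart h; have [f af fh] := exists_chart h^-1%g.
pose lft u := d (cinv d (d h) * cinv c u)%g.
pose rgt v := c (cinv d v * cinv f (f h^-1))%g.
have lftE : lft e = d h by rewrite /lft !chartK// mulg1.
have dlft : differentiable lft e.
  have h1 : differentiable (fun uv => d (cinv d uv.1 * cinv c uv.2)%g) (d h, e).
    by apply: mulg_diff; rewrite ?mulg1.
  exact: (differentiable_comp (@ex_diff _ _ _ _ _ _ _ (is_diff_pair1 _ _)) h1).
have drgt : differentiable rgt (lft e).
  rewrite lftE.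
  have h1 : differentiable (fun uv => c (cinv d uv.1 * cinv f uv.2)%g)
      (d h, f h^-1%g).
    by apply: mulg_diff; rewrite ?mulgV.
  exact: (differentiable_comp (@ex_diff _ _ _ _ _ _ _ (is_diff_pair2 _ _)) h1).
apply: (proj1 (near_eq_diff _ (differentiable_comp dlft drgt))).
have := near_lmul1 ad dh; apply: filterS => u /= hu.
by rewrite /rgt /lft /conj_chart /= !chartK.
Qed.

Lemma conj_chartM h k : \forall u \near e,
  conj_chart h (conj_chart k u) = conj_chart (h * k)%g u.
Proof.
have := near_conj k; apply: filterS => u ku.
by rewrite /conj_chart chartK// invgM !mulgA.
Qed.

(** The chain rule, applied to the composition of two conjugations, which fix the
    identity. *)
Lemma chart_AdM h k X : chart_Ad c (h * k)%g X = chart_Ad c h (chart_Ad c k X).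
Proof.
have dk := conj_chart_diff k.
have dh : differentiable (conj_chart h) (conj_chart k e).
  by rewrite conj_chart1; exact: conj_chart_diff.
have [_ E] := near_eq_diff (conj_chartM h k) (differentiable_comp dk dh).
apply: etrans (congr1 (@^~ X) E) _.
apply: etrans (congr1 (@^~ X) (diff_comp dk dh)) _ => /=.
by rewrite conj_chart1.
Qed.

Lemma chart_Ad1 X : chart_Ad c (1 : G)%g X = X.
Proof.
have nearE : \forall u \near e, id u = conj_chart 1%g u.
  have := near_cran ac (cran_chart c1); apply: filterS => u cu.
  by rewrite /conj_chart mul1g invg1 mulg1 cinvK.
have did : differentiable id e by [].
have [_ E] := near_eq_diff nearE did.
by apply: etrans (congr1 (@^~ X) E) _; rewrite diff_val.
Qed.

Lemma chart_Ad_linear h : linear (chart_Ad c h).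
Proof. by move=> a X Y; rewrite /chart_Ad linearP. Qed.

Let m (uv : 'rV[R]_n * 'rV[R]_n) : 'rV[R]_n := c (cinv c uv.1 * cinv c uv.2)%g.
Let iota u : 'rV[R]_n := c (cinv c u)^-1%g.

Let iota1 : iota e = e.
Proof. by rewrite /iota chartK// invg1. Qed.

Let iota_diff : differentiable iota e.
Proof.
have [+ _] := lie_inv_smooth _ _ ac ac 1%N; apply; split; first exact: cran_chart.
by rewrite chartK// invg1.
Qed.

Let m_diff x y : cdom c x -> cdom c y -> cdom c (x * y)%g ->
  differentiable m (c x, c y).
Proof. exact: mulg_diff. Qed.

Let m_diff2 (v : 'rV[R]_n * 'rV[R]_n) : differentiable (fun p => 'd m p v) (e, e).
Proof.
have [_ /(_ v)[+ _]] := lie_mul_smooth _ _ _ ac ac ac 2%N; apply.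
by split=> /=; rewrite ?chartK ?mulg1//; exact: cran_chart.
Qed.

(** For [h] and [x] both close to the identity everything happens in the single
    chart [c]: with [m] the multiplication and [iota] the inverse in coordinates,
    [h x h^-1] is [m (m (h, x), iota h)], and the chain rule in [x] gives [Ad h]
    as a product of two partial differentials of [m]. *)
Let chart_Ad_near Y : \forall u \near e,
  'd m (u, iota u) ('d m (u, e) (0, Y), 0) = chart_Ad c (cinv c u) Y.
Proof.
have inear : \forall u \near e, cdom c (cinv c u)^-1%g.
  have : (cinv c u)^-1%g @[u --> e] --> (1 : G)%g.
    rewrite -[X in _ --> X]invg1; apply: continuous_cvg cvg_cinv1.
    exact: (@lie_inv_continuous R n G 1%g).
  by move/(_ _ (near_cdom ac c1)).
have := near_cran ac (cran_chart c1); apply: filterS2 inear => u iu cu.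
have := cdom_cinv ac cu; set h := cinv c u => ch.
have uE : u = c h by rewrite cinvK.
pose q w := m (u, w).
have dq : differentiable q e /\ 'd q e = (fun v => 'd m (u, e) (0, v)) :> (_ -> _).
  have d1 : differentiable m (u, e) by rewrite uE; apply: m_diff; rewrite ?mulg1.
  have [d2 E2] := is_diff_pair1 u e.
  split; first exact: (differentiable_comp d2 d1).
  by apply: etrans (diff_comp d2 d1) _; rewrite E2.
have qe : q e = u by rewrite /q /m/= chartK// mulg1 cinvK.
pose r w := m (w, iota u).
have dr : differentiable r (q e) /\
    'd r (q e) = (fun v => 'd m (u, iota u) (v, 0)) :> (_ -> _).
  rewrite qe.
  have d1 : differentiable m (u, iota u).
    by have := @m_diff h h^-1%g; rewrite -uE; apply; rewrite ?mulgV.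
  have [d2 E2] := is_diff_pair2 (iota u) u.
  split; first exact: (differentiable_comp d2 d1).
  by apply: etrans (diff_comp d2 d1) _; rewrite E2.
have nearE : \forall w \near e, (r \o q) w = conj_chart h w.
  have := near_lmul1 ac ch; apply: filterS => w /= hw.
  by rewrite /r /q /m /iota /conj_chart /= -/h !chartK.
have [_ E] := near_eq_diff nearE (differentiable_comp dq.1 dr.1).
apply: esym; apply: etrans (congr1 (@^~ Y) E) _.
apply: etrans (congr1 (@^~ Y) (diff_comp dq.1 dr.1)) _ => /=.
apply: etrans (congr1 (@^~ _) dr.2) _ => /=.
by rewrite (congr1 (@^~ Y) dq.2).
Qed.

(** By [chart_Ad_near] the dependence on [h] is through first differentials of the
    multiplication, which are differentiable because the multiplication is twice
    differentiable. *)
Lemma chart_Ad_diff Y : differentiable (fun u => chart_Ad c (cinv c u) Y) e.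
Proof.
apply: (proj1 (near_eq_diff (chart_Ad_near Y) _)).
apply: (@differentiable_eval _ _ _ _
  (fun u v => 'd m (u, iota u) (v, 0)) (fun u => 'd m (u, e) (0, Y))).
- move=> u a X Z.
  have -> : (a *: X + Z, 0) = a *: (X, 0) + (Z, 0) :> 'rV[R]_n * 'rV[R]_n.
    congr pair; apply: esym; apply: etrans (addr0 _) _; exact: scaler0.
  exact: linearP.
- move=> v.
  have did : differentiable (id : 'rV[R]_n -> _) e by [].
  have d2 := differentiable_pair did iota_diff.
  apply: (differentiable_comp (g := fun p => 'd m p (v, 0)) d2).
  rewrite /= iota1; exact: (@m_diff2 (v, 0)).
- have [d2 _] := is_diff_pair2 e e.
  exact: (differentiable_comp d2 (@m_diff2 (0, Y))).
Qed.

Lemma chart_bracketE X Y :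
  chart_bracket c X Y = 'd (fun u => chart_Ad c (cinv c u) Y) e X.
Proof. by rewrite /chart_bracket deriveE//; exact: chart_Ad_diff. Qed.

(** Differentiate [Ad h (Ad x (Y)) = Ad (h x h^-1) (Ad h (Y))] with respect to [x]
    at the identity: the conjugation [x |-> h x h^-1] has differential [Ad h]
    there. *)
Lemma chart_Ad_bracket h X Y :
  chart_Ad c h (chart_bracket c X Y) =
  chart_bracket c (chart_Ad c h X) (chart_Ad c h Y).
Proof.
pose psi Z u := chart_Ad c (cinv c u) Z.
pose dA := 'd (conj_chart h) e.
have dpsi Z : differentiable (psi Z) e by exact: chart_Ad_diff.
have dc := conj_chart_diff h.
have cA : continuous dA by exact: diff_continuous.
have dAd : differentiable dA (psi Y e) by exact: linear_differentiable.
have dR : differentiable (psi (chart_Ad c h Y)) (conj_chart h e).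
  exact: (eq_ind_r (fun z => differentiable (psi _) z) (dpsi _) (conj_chart1 h)).
have nearE : \forall u \near e, (dA \o psi Y) u =
    (psi (chart_Ad c h Y) \o conj_chart h) u.
  have := near_conj h; apply: filterS => u hu.
  apply: etrans (esym (chart_AdM h (cinv c u) Y)) _.
  rewrite /psi /conj_chart /= chartK//.
  by apply: etrans (chart_AdM _ _ _); rewrite -mulgA mulVg mulg1.
have [_ E] := near_eq_diff nearE (differentiable_comp (dpsi Y) dAd).
rewrite !chart_bracketE.
apply: (@etrans _ _ ('d (dA \o psi Y) e X)).
  apply: esym; apply: etrans (congr1 (@^~ X) (diff_comp (dpsi Y) dAd)) _ => /=.
  exact: (congr1 (@^~ ('d (psi Y) e X)) (diff_lin (psi Y e) cA)).
apply: etrans (esym (congr1 (@^~ X) E)) _.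
apply: etrans (congr1 (@^~ X) (diff_comp dc dR)) _.
exact: (congr1 (fun z => 'd (psi (chart_Ad c h Y)) z (dA X)) (conj_chart1 h)).
Qed.

(** Differentiability gives continuity at the identity, and the homomorphism
    property transports it to every point. *)
Lemma chart_Ad_continuous Y : continuous (fun h => chart_Ad c h Y).
Proof.
move=> h.
have at1 Z : chart_Ad c k Z @[k --> (1 : G)%g] --> Z.
  have psie : chart_Ad c (cinv c e) Z = Z by rewrite chartK// chart_Ad1.
  have : (fun u => chart_Ad c (cinv c u) Z) (c k) @[k --> (1 : G)%g] --> Z.
    rewrite -[X in _ --> X]psie.
    apply: (@cvg_comp _ _ _ c (fun u => chart_Ad c (cinv c u) Z) _ (nbhs e)).
      exact: chart_continuous.
    exact: (differentiable_continuous (chart_Ad_diff Z)).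
  apply: cvg_trans; apply: near_eq_cvg.
  by have := near_cdom ac c1; apply: filterS => k ck; rewrite chartK.
rewrite /continuous_at.
have -> : (fun k => chart_Ad c k Y) =
    (fun k => chart_Ad c k (chart_Ad c h Y)) \o (fun k => (k * h^-1)%g).
  by apply/funext => k /=; rewrite -chart_AdM -mulgA mulVg mulg1.
apply: (cvg_comp _ _ _ (at1 _)).
by apply: mulgr_cvg (@cvg_id _ (nbhs h)); rewrite mulgV.
Qed.

End Conjugation.

(** * The Killing form and the Cartan decomposition *)

Section KillingForm.
Variables (R : realType) (g : lieAlgType R).
Implicit Types (x y z : g) (A : 'End(g)).

Lemma adE x y : ad x y = lie x y.
Proof. by rewrite lfunE. Qed.

Lemma lieC x y : lie x y = - lie y x.
Proof.
have := liexx (x + y); rewrite linearD/=.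
have lD z : lie (x + y) z = lie x z + lie y z.
  by have := lie_linearl z 1 x y; rewrite !scale1r.
rewrite !lD !liexx add0r addr0 addrC => /eqP.
by rewrite addr_eq0 => /eqP.
Qed.

Lemma lie_jacobiE x y z : lie (lie x y) z = lie x (lie y z) - lie y (lie x z).
Proof.
have := lie_jacobi x y z; rewrite (lieC z x) (lieC z (lie x y)) linearN /=.
by move/eqP; rewrite subr_eq0 => /eqP <-.
Qed.

Lemma ad_lie x y : ad (lie x y) = ((ad x \o ad y) - (ad y \o ad x))%VF.
Proof.
apply/lfunP => z; rewrite add_lfunE opp_lfunE !comp_lfunE !adE.
exact: lie_jacobiE.
Qed.

Let M x := passmx.mxof (vbasis {:g}) (vbasis {:g}) (ad x).

Let killingE x y : killing x y = \tr (M y *m M x).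
Proof. by rewrite /killing (passmx.mxof_comp _ _ (vbasisP _)). Qed.

Let M_linear : linear M.
Proof.
move=> a x y; rewrite /M; have -> : ad (a *: x + y) = a *: ad x + ad y.
  by apply/lfunP => z; rewrite add_lfunE scale_lfunE !adE; exact: lie_linearl.
exact: passmx.mxof_linear.
Qed.

Lemma killingC x y : killing x y = killing y x.
Proof. by rewrite !killingE mxtrace_mulC. Qed.

Lemma killing_linearr x : linear (killing x).
Proof.
move=> a y z; rewrite !killingE M_linear mulmxDl -scalemxAl.
by rewrite mxtraceD mxtraceZ.
Qed.

HB.instance Definition _ x := GRing.isSemilinear.Build R g R^o _ (@killing R g x)
  (GRing.semilinear_linear (killing_linearr x)).

(** Invariance of the Killing form: both sides are traces of triple products,
    equal up to a cyclic permutation. *)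
Lemma killing_lie x y z : killing (lie x y) z = killing x (lie y z).
Proof.
have ME u v : M (lie u v) = M v *m M u - M u *m M v.
  rewrite /M ad_lie -scaleN1r addrC passmx.mxof_linear scaleN1r addrC.
  by rewrite !(passmx.mxof_comp _ _ (vbasisP _)).
rewrite !killingE !ME mulmxBr mulmxBl !linearB /= !mulmxA; congr (_ - _).
by rewrite mxtrace_mulC mulmxA.
Qed.

(** An automorphism [A] conjugates [ad x] into [ad (A x)], and the trace is
    invariant under conjugation. *)
Lemma killing_automorphism A A' x y : cancel A' A ->
  (forall u v, A (lie u v) = lie (A u) (A v)) ->
  killing (A x) (A y) = killing x y.
Proof.
move=> AK Alie.
pose mA := passmx.mxof (vbasis {:g}) (vbasis {:g}) A.
pose mA' := passmx.mxof (vbasis {:g}) (vbasis {:g}) A'.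
have mAA' : mA' *m mA = 1%:M.
  rewrite -(passmx.mxof_comp _ _ (vbasisP _)) -(passmx.mxof1 (basis_free (vbasisP _))).
  by congr passmx.mxof; apply/lfunP => v; rewrite comp_lfunE lfunE/= AK.
have E u : M (A u) = mA' *m M u *m mA.
  rewrite -[LHS]mul1mx -mAA' -!mulmxA; congr mulmx.
  rewrite -!(passmx.mxof_comp _ _ (vbasisP _)); congr passmx.mxof.
  by apply/lfunP => v; rewrite !comp_lfunE !adE Alie.
rewrite !killingE !E -!mulmxA (mulmxA mA) (mulmx1C mAA') mul1mx.
by rewrite mxtrace_mulC -!mulmxA (mulmx1C mAA') mulmx1.
Qed.

End KillingForm.

Section CartanDecomposition.
Variables (R : realType) (g : lieAlgType R) (theta : 'End(g)).
Hypothesis thetaP : cartan_involution theta.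
Implicit Types (x y z u v : g).

Let theta_lie x y : theta (lie x y) = lie (theta x) (theta y).
Proof. by case: thetaP. Qed.

Let thetaK : involutive theta.
Proof. by case: thetaP. Qed.

Let theta_pos x : x != 0 -> 0 < - killing x (theta x).
Proof. by case: thetaP => _ _; apply. Qed.

Lemma cartan_kP x : (x \in cartan_k theta) = (theta x == x).
Proof. by rewrite memv_ker add_lfunE opp_lfunE scale_lfunE id_lfunE scale1r subr_eq0. Qed.

Lemma cartan_pP x : (x \in cartan_p theta) = (theta x == - x).
Proof.
by rewrite memv_ker add_lfunE opp_lfunE scale_lfunE id_lfunE scaleN1r opprK addr_eq0.
Qed.

Lemma killing_theta x y : killing (theta x) (theta y) = killing x y.
Proof. exact: (@killing_automorphism _ _ theta theta). Qed.

Lemma killing_kp x y : x \in cartan_k theta -> y \in cartan_p theta ->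
  killing x y = 0.
Proof.
rewrite cartan_kP cartan_pP => /eqP kx /eqP py.
have := killing_theta x y; rewrite kx py linearN/= => /eqP.
by rewrite eqNr => /eqP.
Qed.

Lemma killing_k_eq0 x : x \in cartan_k theta -> killing x x = 0 -> x = 0.
Proof.
rewrite cartan_kP => /eqP kx x0; apply/eqP; apply: contraT => /theta_pos.
by rewrite kx x0 oppr0 ltxx.
Qed.

(** The p-part is the whole orthogonal of the k-part: for [x] in that orthogonal
    the k-component [x + theta x] is orthogonal to itself, hence zero. An
    isometry preserving the k-part then preserves the p-part. *)
Lemma cartan_p_orth x : (forall y, y \in cartan_k theta -> killing y x = 0) ->
  x \in cartan_p theta.
Proof.
move=> kx.
pose u := x + theta x.
have ku : u \in cartan_k theta by rewrite cartan_kP linearD/= thetaK addrC.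
suff : u = 0 by rewrite cartan_pP -addr_eq0 addrC => /eqP.
apply: killing_k_eq0 => //; rewrite {2}/u linearD/= kx// add0r.
by move: (ku); rewrite cartan_kP => /eqP E; rewrite -E killing_theta kx.
Qed.

Lemma lie_pp x y : x \in cartan_p theta -> y \in cartan_p theta ->
  lie x y \in cartan_k theta.
Proof.
rewrite !cartan_pP cartan_kP => /eqP px /eqP py.
by rewrite theta_lie px py linearN/= (lieC (- x)) opprK linearN/= -lieC.
Qed.

(** The positive definite form attached to [theta]; it agrees with the Killing
    form on the p-part. *)
Definition theta_form x y : R := - killing x (theta y).

Lemma theta_form_p x y : y \in cartan_p theta -> theta_form x y = killing x y.
Proof.
by rewrite cartan_pP /theta_form => /eqP ->; rewrite linearN opprK.
Qed.

Lemma theta_formC x y : theta_form x y = theta_form y x.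
Proof. by rewrite /theta_form -killing_theta thetaK killingC. Qed.

Lemma theta_form_linear x : linear (theta_form x).
Proof. by move=> a y z; rewrite /theta_form linearP killing_linearr opprD scalerN. Qed.

Lemma theta_form_gt0 x : x != 0 -> 0 < theta_form x x.
Proof. exact: theta_pos. Qed.

End CartanDecomposition.

(** * The adjoint representation on the Lie algebra *)

Section AdjointAction.
Variables (R : realType) (n : nat) (G : lieGroupType R n) (g : lieAlgType R).
Variable L : has_lie_algebra G g.
Implicit Types (h k : G) (x y z u : g).

Local Notation c := (id_chart L).
Local Notation T := (to_tangent L).
Let ac : atlas c := id_chart_atlas L.
Let c1 : cdom c 1%g := id_chart_dom L.

Let tangentK : cancel T (T^-1)%VF.
Proof. by apply/lker0_lfunK/lker0P/bij_inj/to_tangent_bij. Qed.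

Let tangentVK : cancel (T^-1)%VF T.
Proof.
move=> v; have [T' TK TK'] := to_tangent_bij L.
by rewrite -[v]TK' tangentK.
Qed.

Lemma to_tangent_Ad h x : T (Ad L h x) = chart_Ad c h (T x).
Proof. by rewrite /Ad tangentVK. Qed.

Lemma Ad_linear h : linear (Ad L h).
Proof.
move=> a x y; apply: (can_inj tangentK).
have TP u v : T (a *: u + v) = a *: T u + T v by exact: linearP.
by rewrite TP !to_tangent_Ad TP chart_Ad_linear.
Qed.

HB.instance Definition _ h := GRing.isSemilinear.Build R g g _ (Ad L h)
  (GRing.semilinear_linear (Ad_linear h)).

Lemma AdM h k x : Ad L (h * k)%g x = Ad L h (Ad L k x).
Proof.
by apply: (can_inj tangentK); rewrite !to_tangent_Ad; exact: chart_AdM ac c1 _ _ _.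
Qed.

Lemma Ad1 x : Ad L 1%g x = x.
Proof.
by apply: (can_inj tangentK); rewrite !to_tangent_Ad; exact: chart_Ad1 ac c1 _.
Qed.

Lemma AdVK h : cancel (Ad L h^-1%g) (Ad L h).
Proof. by move=> x; rewrite -AdM mulgV Ad1. Qed.

Lemma AdK h : cancel (Ad L h) (Ad L h^-1%g).
Proof. by move=> x; rewrite -AdM mulVg Ad1. Qed.

Lemma Ad_lie h x y : Ad L h (lie x y) = lie (Ad L h x) (Ad L h y).
Proof.
apply: (can_inj tangentK); rewrite to_tangent_lie !to_tangent_Ad to_tangent_lie.
exact: chart_Ad_bracket ac c1 _ _ _.
Qed.

Lemma killing_Ad h x y : killing (Ad L h x) (Ad L h y) = killing x y.
Proof.
have E : killing (linfun (Ad L h) x) (linfun (Ad L h) y) = killing x y.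
  apply: (@killing_automorphism _ _ _ (linfun (Ad L h^-1%g))).
    by move=> z; rewrite !lfunE/= AdVK.
  by move=> u v; rewrite !lfunE/= Ad_lie.
by move: E; rewrite !lfunE.
Qed.

(** Scalar coordinates of the Lie algebra, read on the tangent space: they reduce
    derivatives of curves in [g], which carries no topology, to derivatives of
    real functions. *)
Definition pairing z (v : 'rV[R]_n) : R^o := killing z ((T^-1)%VF v).

Lemma pairing_linear z : linear (pairing z).
Proof. by move=> a u v; rewrite /pairing linearP killing_linearr. Qed.

HB.instance Definition _ z := GRing.isSemilinear.Build R 'rV[R]_n R^o _ (pairing z)
  (GRing.semilinear_linear (pairing_linear z)).

Lemma killing_Ad_continuous x z : continuous (fun k => killing z (Ad L k x) : R).
Proof.
move=> k; apply: (@cvg_comp _ _ _ (fun k => chart_Ad c k (T x)) (pairing z)).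
  exact: chart_Ad_continuous ac c1 _ _.
exact: (differentiable_continuous (linear_rV_differentiable (pairing z) _)).
Qed.

(** The velocity of [Ad (gam s) x] at [s = 0] is [lie u x]: this is where the
    bracket of the Lie algebra, defined as the derivative of [Ad] in a chart,
    meets the one-parameter group of velocity [u]. *)
Lemma one_parameter_derive0 (gam : R -> G) u x z :
  continuous gam -> gam 0 = 1%g ->
  is_derive (0 : R) (1 : R) (c \o gam) (T u) ->
  is_derive (0 : R) 1 (fun s => killing z (Ad L (gam s) x) : R)
    (killing z (lie u x)).
Proof.
move=> cgam gam0 [dgam0 dgamE].
pose psi v := chart_Ad c (cinv c v) (T x).
pose cg := c \o gam.
have cg0 : cg 0 = c 1%g by rewrite /cg /= gam0.
have dcg : differentiable cg 0 by exact/derivable1_diffP.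
have dpsi : differentiable psi (cg 0).
  by rewrite cg0; exact: chart_Ad_diff ac c1 (T x).
have dz : differentiable (pairing z : _ -> R) (psi (cg 0)).
  exact: linear_rV_differentiable.
have dpc := differentiable_comp dcg dpsi.
have dall := differentiable_comp dpc dz.
have near0 : \forall s \near (0 : R),
    ((pairing z : _ -> R) \o (psi \o cg)) s = killing z (Ad L (gam s) x).
  have : \forall s \near (0 : R), cdom c (gam s).
    by have /(_ _ (near_cdom ac _)) := cgam 0; apply; rewrite gam0.
  apply: filterS => s cs.
  by rewrite /pairing /psi /cg /= chartK// -to_tangent_Ad tangentK.
apply: near_eq_is_derive near0 _.
apply: DeriveDef; first exact/derivable1_diffP.
apply: etrans (deriveE _ dall) _.
apply: etrans (congr1 (@^~ 1) (diff_comp dpc dz)) _.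
have cp : continuous (pairing z : _ -> R).
  move=> v.
  exact: (differentiable_continuous (linear_rV_differentiable (pairing z) v)).
apply: etrans (congr1 (@^~ _) (diff_lin _ cp)) _.
rewrite /pairing; congr killing; apply: (can_inj tangentK).
rewrite tangentVK to_tangent_lie.
apply: etrans (congr1 (@^~ 1) (diff_comp dcg dpsi)) _.
rewrite (chart_bracketE ac c1) /=.
have -> : 'd cg 0 1 = T u by apply: etrans (esym (deriveE _ dcg)) dgamE.
by rewrite -/psi cg0.
Qed.

Lemma one_parameter0 (gam : R -> G) :
  (forall s t, gam (s + t) = (gam s * gam t)%g) -> gam 0 = 1%g.
Proof.
by move=> gamD; have E := gamD 0 0; rewrite -[LHS](mulKg (gam 0)) -E addr0 mulVg.
Qed.

(** Translation of the case [t = 0] along the one-parameter group. *)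
Lemma one_parameter_derive (gam : R -> G) u x z (t : R) :
  continuous gam -> (forall s t, gam (s + t) = (gam s * gam t)%g) ->
  is_derive (0 : R) (1 : R) (c \o gam) (T u) ->
  is_derive t 1 (fun s => killing z (Ad L (gam s) x) : R)
    (killing z (Ad L (gam t) (lie u x))).
Proof.
move=> cgam gamD dgam; have gam0 := one_parameter0 gamD.
pose z' := Ad L (gam t)^-1%g z.
have zE y : killing z (Ad L (gam t) y) = killing z' y.
  by rewrite -[in LHS](AdVK (gam t) z) killing_Ad.
have D0 : is_derive (t - t) 1 (fun s => killing z' (Ad L (gam s) x) : R)
    (killing z' (lie u x)).
  by rewrite subrr; exact: one_parameter_derive0.
have ds : is_derive t 1 (fun s : R => s - t) 1 by exact: is_derive_shift.
have fE : (fun s => killing z (Ad L (gam s) x) : R) =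
    (fun s => killing z' (Ad L (gam s) x) : R) \o (fun s => s - t).
  apply/funext => s /=; rewrite -{1}(subrK t s) addrC gamD AdM.
  exact: zE.
rewrite fE zE -[X in is_derive _ _ _ X](mulr1 (killing z' (lie u x) : R)).
exact: is_derive1_comp.
Qed.

(** A one-parameter group fixes what its generator annihilates, since all the
    coordinates of the orbit have zero derivative. *)
Lemma one_parameter_fix (gam : R -> G) u x :
  continuous gam -> (forall s t, gam (s + t) = (gam s * gam t)%g) ->
  is_derive (0 : R) (1 : R) (c \o gam) (T u) ->
  (forall z : g, (forall y, killing y z = 0) -> z = 0) ->
  lie u x = 0 -> forall t, Ad L (gam t) x = x.
Proof.
move=> cgam gamD dgam nondeg ux t.
apply/eqP; rewrite -subr_eq0; apply/eqP; apply: nondeg => y.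
rewrite linearB /=; apply/eqP; rewrite subr_eq0 -[x in X in _ == X]Ad1.
rewrite -(one_parameter0 gamD); apply/eqP.
apply: (@is_derive_0_is_cst _ (fun s => killing y (Ad L (gam s) x) : R)) => s.
have := one_parameter_derive x y s cgam gamD dgam.
by rewrite ux !linear0.
Qed.

Lemma conj_one_parameter (gam : R -> G) u k :
  continuous gam -> (forall s t, gam (s + t) = (gam s * gam t)%g) ->
  is_derive (0 : R) (1 : R) (c \o gam) (T u) ->
  let gam' t := (k * gam t * k^-1)%g in
  [/\ continuous gam', forall s t, gam' (s + t) = (gam' s * gam' t)%g &
      is_derive (0 : R) (1 : R) (c \o gam') (T (Ad L k u))].
Proof.
move=> cgam gamD [dgam0 dgamE] gam'; have gam0 := one_parameter0 gamD.
split.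
- move=> t; apply: (@mulgr_cvg _ _ _ _ _ _ _ (k * gam t)%g) => //.
  by apply: (@mulgl_cvg _ _ _ _ _ _ _ k (gam t)) => //; exact: cgam.
- by move=> s t; rewrite /gam' gamD !mulgA mulgVK.
pose cg := c \o gam.
have cg0 : cg 0 = c 1%g by rewrite /cg /= gam0.
have dcg : differentiable cg 0 by exact/derivable1_diffP.
have dk : differentiable (conj_chart c k) (cg 0).
  by rewrite cg0; exact: (conj_chart_diff ac c1 k).
have dall := differentiable_comp dcg dk.
have near0 : \forall s \near (0 : R), (conj_chart c k \o cg) s = (c \o gam') s.
  have : \forall s \near (0 : R), cdom c (gam s).
    by have /(_ _ (near_cdom ac _)) := cgam 0; apply; rewrite gam0.
  by apply: filterS => s cs; rewrite /cg /conj_chart /= chartK.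
apply: near_eq_is_derive near0 _.
apply: DeriveDef; first exact/derivable1_diffP.
apply: etrans (deriveE _ dall) _.
apply: etrans (congr1 (@^~ 1) (diff_comp dcg dk)) _.
rewrite to_tangent_Ad /=.
have -> : 'd cg 0 1 = T u by apply: etrans (esym (deriveE _ dcg)) dgamE.
by rewrite chart_AdE cg0.
Qed.

End AdjointAction.

(* Only the algebraic laws of [Ad] matter from here on, not its expression as
   the differential of a map between charts. *)
Opaque Ad.

(** * The compact group acting on the Lie algebra *)

Section CompactAction.
Variables (R : realType) (n : nat) (G : lieGroupType R n) (g : lieAlgType R).
Variables (theta : 'End(g)) (L : has_lie_algebra G g) (K : set G).
Hypothesis thetaP : cartan_involution theta.
Hypothesis subK : subgroup K.
Hypothesis compactK : compact K.
Hypothesis lieK : subgroup_lie_algebra L K = [set` cartan_k theta].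
Implicit Types (k l : G) (x y z u w h : g) (B : set g).

Local Notation p := (cartan_p theta).
Local Notation stab := (pointwise_stabilizer L K).

Lemma subgroup1 : K 1%g.
Proof. by case: subK. Qed.

Lemma subgroupV k : K k -> K k^-1%g.
Proof. by case: subK => K1 KM Kk; rewrite -[k^-1%g]mul1g; exact: KM. Qed.

Lemma subgroupM k l : K k -> K l -> K (k * l)%g.
Proof.
move=> Kk Kl; rewrite -[l]invgK; case: subK => _ KM.
exact/KM/subgroupV.
Qed.

Lemma killing_nondeg x : (forall y, killing y x = 0) -> x = 0.
Proof.
move=> x0; apply/eqP; apply: contraT => /(theta_form_gt0 thetaP).
by rewrite /theta_form killingC x0 oppr0 ltxx.
Qed.

(** Conjugating by [k] the one-parameter group generated by [u] gives the one
    generated by [Ad k u], and both stay in [K]. *)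
Lemma Ad_cartan_k k u : K k -> u \in cartan_k theta ->
  Ad L k u \in cartan_k theta.
Proof.
have lieKE v : subgroup_lie_algebra L K v <-> v \in cartan_k theta by rewrite lieK.
move=> Kk /lieKE[gam [cgam gamD dgam Kgam]]; apply/lieKE.
have [c1 c2 c3] := conj_one_parameter k cgam gamD dgam.
exists (fun t => k * gam t * k^-1)%g; split=> // t.
by apply: subgroupM; [exact: subgroupM|exact: subgroupV].
Qed.

Lemma Ad_cartan_p k x : K k -> x \in p -> Ad L k x \in p.
Proof.
move=> Kk px; apply: cartan_p_orth => // y ky.
rewrite -(AdVK L k y) killing_Ad; apply: (killing_kp thetaP) => //.
by apply: Ad_cartan_k => //; exact: subgroupV.
Qed.

Lemma stab1 B : stab B 1%g.
Proof. by split; [exact: subgroup1|move=> x _; rewrite Ad1]. Qed.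

Lemma stabM B k l : stab B k -> stab B l -> stab B (k * l)%g.
Proof.
move=> [Kk kB] [Kl lB]; split; first exact: subgroupM.
by move=> x Bx; rewrite AdM lB// kB.
Qed.

Lemma stabV B k : stab B k -> stab B k^-1%g.
Proof.
move=> [Kk kB]; split; first exact: subgroupV.
by move=> x Bx; rewrite -[in LHS](kB _ Bx) AdK.
Qed.

Lemma stabS B B' k : B `<=` B' -> stab B' k -> stab B k.
Proof. by move=> sB [Kk kB]; split=> // x /sB; exact: kB. Qed.

(** The equations [Ad k xi = xi] are closed conditions, tested against the
    nondegenerate Killing form. *)
Lemma stab_compact B : compact (stab B).
Proof.
have -> : stab B = K `&` \bigcap_(x in B) \bigcap_z
    (fun k => killing z (Ad L k x) : R) @^-1` [set killing z x].
  apply/seteqP; split=> k [Kk kB]; split=> // x Bx; first by move=> z _ /=; rewrite kB.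
  apply/eqP; rewrite -subr_eq0; apply/eqP/killing_nondeg => z.
  by rewrite linearB /= (kB x Bx z)// subrr.
apply: compact_closedI => //.
apply: closed_bigI => x _; apply: closed_bigI => z _.
apply: closed_comp; last exact: closed_eq.
by move=> k _; exact: killing_Ad_continuous.
Qed.

Lemma max_on_stab B h y :
  exists2 k, stab B k & forall k', stab B k' ->
    killing h (Ad L k' y) <= killing h (Ad L k y).
Proof.
have cf : {within stab B, continuous (fun k => killing h (Ad L k y) : R)}.
  by apply: continuous_subspaceT => k; exact: killing_Ad_continuous.
have [k /set_mem kB kmax] := compact_EVT_max (ex_intro _ _ (stab1 B)) (@stab_compact B) cf.
exists k; first exact: kB.
move=> k' k'B; exact: (kmax k' (mem_set k'B)).
Qed.

(** First variation: the bracket [y, h] generates a one-parameter group of the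
    stabiliser, along which the height [killing h] has derivative
    [killing w w], [w] being the bracket; the Killing form is negative definite
    on the k-part. *)
Lemma commute_of_max B y h : y \in p -> h \in p ->
  (forall b, B b -> lie b y = 0) -> (forall b, B b -> lie b h = 0) ->
  (forall k, stab B k -> killing h (Ad L k y) <= killing h y) ->
  lie y h = 0.
Proof.
move=> py ph By Bh ymax; set w := lie y h.
have kw : w \in cartan_k theta by exact: lie_pp.
have wB b : B b -> lie w b = 0.
  move=> Bb; rewrite /w lie_jacobiE (lieC h b) (lieC y b) By// Bh//.
  by rewrite !oppr0 !linear0 addr0.
have [gam [cgam gamD dgam Kgam]] : subgroup_lie_algebra L K w by rewrite lieK.
have gamB t : stab B (gam t).
  split=> // b Bb; apply: (one_parameter_fix cgam gamD dgam); last exact: wB.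
  exact: killing_nondeg.
pose f t : R := killing h (Ad L (gam t) y).
have df t := one_parameter_derive y h t cgam gamD dgam.
have gam0 := one_parameter0 gamD.
have D0 : is_derive (0 : R) 1 f 0.
  apply: (@derive1_at_max _ f (-1) 1 0).
  - by lra.
  - by move=> t _; have [] := df t.
  - by rewrite in_itv/=; lra.
  - by move=> t _; rewrite /f gam0 Ad1; apply: ymax.
have hw : killing h (lie w y) = 0.
  by have [_ <-] := D0; have [_] := df 0; rewrite gam0 Ad1 => <-.
apply: (killing_k_eq0 thetaP kw).
by rewrite {2}/w -killing_lie killingC.
Qed.

End CompactAction.

(** * Conjugation into a maximal abelian subspace *)

Section ConjugationIntoMaximalAbelian.
Variables (R : realType) (n : nat) (G : lieGroupType R n) (g : lieAlgType R).
Variables (theta : 'End(g)) (L : has_lie_algebra G g) (K : set G).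
Variable a : {vspace g}.
Hypothesis thetaP : cartan_involution theta.
Hypothesis subK : subgroup K.
Hypothesis compactK : compact K.
Hypothesis lieK : subgroup_lie_algebra L K = [set` cartan_k theta].
Hypothesis maxa : maximal_abelian theta a.
Implicit Types (k l : G) (x y z u w h b : g) (B : set g).

Local Notation p := (cartan_p theta).
Local Notation stab := (pointwise_stabilizer L K).

Definition commutes B y := forall b, B b -> lie b y = 0.

Lemma commutes_Ad B k y : stab B k -> commutes B y -> commutes B (Ad L k y).
Proof.
move=> [_ kB] By b Bb; rewrite -[in LHS](kB b Bb) -Ad_lie By//.
exact: linear0.
Qed.

Lemma maximal_abelian_p x : x \in a -> x \in p.
Proof. by case: maxa => /subvP ap _ _; exact: ap. Qed.

Lemma maximal_abelian_lie x y : x \in a -> y \in a -> lie x y = 0.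
Proof. by case: maxa => _ + _; apply. Qed.

Lemma maximal_abelian_commutes B h : B `<=` [set` a] -> h \in a -> commutes B h.
Proof. by move=> Ba ah b /Ba /= ab; exact: maximal_abelian_lie. Qed.

(** Otherwise [a + <[y]>] would be a larger abelian subspace. *)
Lemma mem_maximal_abelian y : y \in p -> commutes [set` vbasis a] y -> y \in a.
Proof.
move=> py basis_y.
have ay x : x \in a -> lie y x = 0.
  move=> ax; rewrite (coord_vbasis ax) linear_sum big1// => i _.
  rewrite linearZ /= lieC basis_y ?oppr0 ?scaler0//=.
  by rewrite mem_nth// size_tuple.
case: maxa => ap aa /(_ (a + <[y]>)%VS) <-.
- exact/(subvP (addvSr _ _))/memv_line.
- by rewrite subv_add ap -memvE.
- move=> ? ? /memv_addP[x1 ax1 [w1 /vlineP[t1 ->] ->]].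
  move=> /memv_addP[x2 ax2 [w2 /vlineP[t2 ->] ->]].
  set z := x2 + t2 *: y.
  have xz : lie x1 z = 0.
    by rewrite linearD linearZ /= aa// lieC ay// oppr0 scaler0 addr0.
  have yz : lie y z = 0 by rewrite linearD linearZ /= liexx ay// scaler0 addr0.
  by rewrite lieC linearD linearZ /= lieC xz lieC yz !oppr0 scaler0 addr0 oppr0.
- exact: addvSl.
Qed.

(** The heights [killing h], [h] in [s], are maximised one after the other. After
    each step the element commutes with [h], and the next maximisation is done
    inside the stabiliser of [h], which preserves what has been gained. *)
Lemma conj_commutes (s : seq g) B y : {subset s <= a} -> B `<=` [set` a] ->
  y \in p -> commutes B y ->
  exists2 k, stab B k & commutes (B `|` [set` s]) (Ad L k y).
Proof.
elim: s B y => [|h s IH] B y sa Ba py By.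
  exists 1%g; first exact: stab1.
  by rewrite Ad1 => b [/By//|]; rewrite /= in_nil.
have ah : h \in a by apply: sa; rewrite mem_head.
have [k0 k0B k0max] := max_on_stab L thetaP subK compactK B h y.
set y0 := Ad L k0 y.
have py0 : y0 \in p by apply: (Ad_cartan_p thetaP subK lieK); [case: k0B|].
have By0 : commutes B y0 by exact: commutes_Ad.
have hy0 : lie y0 h = 0.
  apply: (@commute_of_max _ _ _ _ _ L K thetaP lieK B y0 h) => //.
  - exact: maximal_abelian_p.
  - exact: maximal_abelian_commutes.
  by move=> k kB; rewrite -AdM; apply/k0max/(stabM subK).
have [|||k1 k1B k1y] := IH (B `|` [set h]) y0 _ _ py0 _.
- by move=> x xs; apply: sa; rewrite inE xs orbT.
- by move=> x [/Ba//|->].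
- by move=> x [/By0//|->]; rewrite lieC hy0 oppr0.
exists (k1 * k0)%g.
  exact: (stabM subK (stabS (@subsetUl _ _ _) k1B) k0B).
rewrite AdM => b [Bb|/=]; first by apply: k1y; left; left.
by rewrite inE => /predU1P[->|bs]; apply: k1y; [left; right|right].
Qed.

Lemma conj_into_abelian B y : B `<=` [set` a] -> y \in p -> commutes B y ->
  exists2 k, stab B k & Ad L k y \in a.
Proof.
move=> Ba py By.
have [|k kB ky] := @conj_commutes (vbasis a) B y _ Ba py By.
  by move=> x; exact: vbasis_mem.
exists k => //; apply: mem_maximal_abelian.
  by apply: (Ad_cartan_p thetaP subK lieK); [case: kB|].
by move=> b bs; apply: ky; right.
Qed.

(** Commuting elements are moved into [a] one at a time; once [y] is there, the
    remaining ones commute with it and are moved by its stabiliser. *)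
Lemma conj_seq_into_abelian (ys : seq g) B : B `<=` [set` a] ->
  {subset ys <= p} -> {in ys, forall y, commutes B y} ->
  {in ys &, forall y z, lie y z = 0} ->
  exists2 k, stab B k & {in ys, forall y, Ad L k y \in a}.
Proof.
have [m sz] := ubnP (size ys).
elim: m ys B sz => // m IH [|y ys] B sz Ba yp By yy.
  by exists 1%g => //; exact: stab1.
have yin : y \in y :: ys by rewrite mem_head.
have tin z : z \in ys -> z \in y :: ys by rewrite inE orbC => ->.
have [k0 k0B k0y] := conj_into_abelian Ba (yp _ yin) (By _ yin).
have kp z : z \in p -> Ad L k0 z \in p.
  by apply: (Ad_cartan_p thetaP subK lieK); case: k0B.
have [|||||k1 k1B k1ys] := IH [seq Ad L k0 z | z <- ys] (B `|` [set Ad L k0 y]) _ _ _ _ _.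
- by rewrite size_map.
- by move=> x [/Ba//|->].
- by move=> _ /mapP[z zs ->]; apply/kp/yp/tin.
- move=> _ /mapP[z zs ->] b [Bb|->]; first exact: (commutes_Ad k0B (By _ (tin _ zs))).
  by rewrite -Ad_lie yy ?linear0// tin.
- move=> _ _ /mapP[z zs ->] /mapP[z' zs' ->].
  by rewrite -Ad_lie yy ?linear0// tin.
exists (k1 * k0)%g.
  exact: (stabM subK (stabS (@subsetUl _ _ _) k1B) k0B).
move=> z; rewrite inE AdM => /predU1P[->|zs]; last by apply: k1ys; exact: map_f.
by case: k1B => _ ->//; right.
Qed.

End ConjugationIntoMaximalAbelian.

(** * Faces of convex sets *)

Lemma coord_inj (R : fieldType) (V : vectType R) (x y : V) :
  (forall i, coord (vbasis {:V}) i x = coord (vbasis {:V}) i y) -> x = y.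
Proof.
move=> xy; rewrite (coord_vbasis (memvf x)) (coord_vbasis (memvf y)).
by apply: eq_bigr => i _; rewrite xy.
Qed.

Lemma coordZ (R : fieldType) (V : vectType R) i (t : R) (x : V) :
  coord (vbasis {:V}) i (t *: x) = t * coord (vbasis {:V}) i x.
Proof. exact: linearZ. Qed.

(** Linear identities between vectors, read off coordinatewise. *)
Ltac vector_field :=
  apply: coord_inj => ?; repeat rewrite ?coordZ ?raddfD ?raddfN /=; field.

Section Faces.
Variables (R : realType) (V : vectType R).
Implicit Types (A C F : set V) (x y z v : V).

Lemma convex_setP C : @convex_set R V C <->
  (forall x y (t : R), 0 <= t <= 1 -> C x -> C y ->
    C ((1 - t) *: x + t *: y)).
Proof.
split=> [cC x y t /andP[t0 t1] Cx Cy|cC x y l /set_mem Cx /set_mem Cy].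
  have := cC y x (Itv01 t0 t1) (mem_set Cy) (mem_set Cx).
  by move/set_mem; rewrite /conv/= addrC.
apply/mem_set; rewrite /conv/= addrC; apply: cC => //.
by rewrite ge0 le1.
Qed.

(** The smallest face of a convex set [C] containing the point [x] of [C]: the
    points [y] such that the segment from [y] to [x] can be prolonged inside [C]
    beyond [x]. The inclusion of [C] in [min_face C x] says that [x] lies in the
    relative interior of [C]. *)
Definition min_face C x : set V :=
  [set y | C y /\ exists2 e : R, 0 < e & C (x + e *: (x - y))].

Lemma min_face_refl C x : C x -> min_face C x x.
Proof. by move=> Cx; split=> //; exists 1 => //; rewrite subrr scaler0 addr0. Qed.

(** Star-shapedness along a ray, which lets an extension parameter be
    decreased. *)
Lemma convex_ray C x v (s e : R) : @convex_set R V C -> C x -> 0 < e ->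
  C (x + e *: v) -> 0 <= s <= e -> C (x + s *: v).
Proof.
move=> /convex_setP cC Cx e0 Ce /andP[s0 se].
have e1 : e != 0 by rewrite gt_eqF.
have -> : x + s *: v = (1 - s / e) *: x + (s / e) *: (x + e *: v).
  by vector_field.
by apply: cC => //; rewrite divr_ge0 ?(ltW e0)//= ler_pdivrMr// mul1r.
Qed.

Lemma face_segment C F x y (t : R) : is_face C F -> C x -> C y -> 0 < t < 1 ->
  F ((1 - t) *: x + t *: y) -> F x /\ F y.
Proof.
move=> [_ _ _ FC] Cx Cy t01 Ft.
have sF : seg x y `<=` F.
  by apply: FC => //; exists ((1 - t) *: x + t *: y); split=> //; exists t.
split; apply: sF; [exists 0|exists 1] => /=.
- by rewrite lexx ler01.
- by rewrite subr0 scale1r scale0r addr0.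
- by rewrite lexx ler01.
- by rewrite subrr scale0r add0r scale1r.
Qed.

Lemma is_faceP C F : F !=set0 -> F `<=` C -> @convex_set R V F ->
  (forall x y (t : R), C x -> C y -> 0 < t < 1 ->
    F ((1 - t) *: x + t *: y) -> F x /\ F y) -> is_face C F.
Proof.
move=> F0 FC cF Fseg; split=> // x y Cx Cy [_ [[t t01 <-] /Fseg]].
move=> /(_ Cx Cy t01)[Fx Fy] _ [s s01 <-].
by move/convex_setP: cF; apply.
Qed.

Lemma min_face_is_face C x : @convex_set R V C -> C x ->
  is_face C (min_face C x).
Proof.
move=> cC Cx; have cC' := (convex_setP C).1 cC.
apply: is_faceP.
- by exists x; exact: min_face_refl.
- by move=> y [].
- apply/convex_setP => y z t t01 [Cy [e1 e10 Ce1]] [Cz [e2 e20 Ce2]].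
  split; first exact: cC'.
  pose e := Num.min e1 e2; exists e; first by rewrite lt_min e10.
  have -> : x + e *: (x - ((1 - t) *: y + t *: z)) =
      (1 - t) *: (x + e *: (x - y)) + t *: (x + e *: (x - z)).
    by vector_field.
  apply: cC' => //.
    by apply: (convex_ray cC Cx e10 Ce1); rewrite /e le_min ge_min lexx (ltW e10) (ltW e20).
  by apply: (convex_ray cC Cx e20 Ce2); rewrite /e le_min ge_min lexx orbT (ltW e10) (ltW e20).
- have key y z (t : R) : C y -> C z -> 0 < t < 1 ->
      min_face C x ((1 - t) *: y + t *: z) -> min_face C x y.
    move=> Cy Cz /andP[t0 t1] [_ [e e0 Ce]]; split=> //.
    (* extending from y through x lands on the segment from the given
       extension to z *)
    have d0 : 0 < 1 + e * t by rewrite addr_gt0// mulr_gt0.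
    exists (e * (1 - t) / (1 + e * t)).
      by rewrite divr_gt0// mulr_gt0// subr_gt0.
    have -> : x + (e * (1 - t) / (1 + e * t)) *: (x - y) =
       (1 - e * t / (1 + e * t)) *: (x + e *: (x - ((1 - t) *: y + t *: z)))
       + (e * t / (1 + e * t)) *: z.
      by vector_field; rewrite gt_eqF.
    apply: cC' => //; rewrite ler_pdivrMr// mul1r lerDr ler01 andbT.
    by rewrite divr_ge0// ltW// mulr_gt0.
  move=> y z t Cy Cz t01 xt; split; first exact: (key y z t).
  apply: (key z y (1 - t)) => //; first by move: t01; lra.
  by rewrite subKr addrC.
Qed.

Lemma min_face_sub C F x : is_face C F -> F x -> min_face C x `<=` F.
Proof.
move=> fF Fx y [Cy [e e0 Ce]].
have d0 : 0 < 1 + e by rewrite addr_gt0.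
have t01 : 0 < (1 + e)^-1 < 1 by rewrite invr_gt0 d0 invf_lt1// ltrDl.
apply: (proj1 (face_segment fF Cy Ce t01 _)).
suff -> : (1 - (1 + e)^-1) *: y + (1 + e)^-1 *: (x + e *: (x - y)) = x by [].
by vector_field; rewrite gt_eqF.
Qed.

(** Existence of a relatively interior point, by algebra: take [x] for which the
    space of directions in which one can move from [x] inside [C] contains a
    subspace [U] of maximal dimension. If some [y] in [C] were outside [x + U],
    the midpoint of [x] and [y] would have more directions. *)
Lemma exists_core C : C !=set0 -> @convex_set R V C ->
  exists2 x, C x & C `<=` min_face C x.
Proof.
move=> [x0 Cx0] cC; have cC' := (convex_setP C).1 cC.
pose Q m := exists x (U : {vspace V}), [/\ C x, \dim U = m &
  forall u, u \in U -> exists2 e : R, 0 < e & C (x + e *: u)].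
have Q0 : exists m, `[< Q m >].
  exists 0%N; apply/asboolP; exists x0, 0%VS; split=> //; first exact: dimv0.
  by move=> u; rewrite memv0 => /eqP ->; exists 1 => //; rewrite scaler0 addr0.
have Qmax m : `[< Q m >] -> (m <= \dim {:V})%N.
  by move=> /asboolP[x [U [_ <- _]]]; apply: dimvS; exact: subvf.
case: (ex_maxnP Q0 Qmax) => m /asboolP[x [U [Cx dimU CU]]] mmax.
exists x => // y Cy; split=> //.
apply: (CU); apply: contraT => xyU; exfalso.
suff /mmax : `[< Q m.+1 >] by rewrite ltnn.
apply/asboolP; exists ((1 - 2^-1) *: x + 2^-1 *: y), (U + <[x - y]>)%VS; split.
- by apply: cC' => //; lra.
- rewrite dimv_disjoint_sum ?dimU ?dim_vline.
    have -> : x - y != 0 by apply: contraNneq xyU => ->; exact: mem0v.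
    by rewrite addn1.
  apply/eqP; rewrite -subv0; apply/subvP => v /memv_capP[vU /vlineP[t vE]].
  rewrite memv0; apply: contraNT xyU => v0.
  have t0 : t != 0 by apply: contraNneq v0 => t0; rewrite vE t0 scale0r.
  by rewrite -[x - y]scale1r -(mulVf t0) -scalerA -vE memvZ.
move=> _ /memv_addP[u uU [w /vlineP[t ->] ->]].
have [e0 e00 Ce0] := CU u uU.
(* both the U-part and the shift along the segment must stay small *)
pose e := Num.min (e0 / 4) (4^-1 / (1 + `|t|)).
have e_gt0 : 0 < e.
  by rewrite lt_min !divr_gt0// ?invr_gt0// ltr_wpDr.
have et : `|e * t| <= 4^-1.
  rewrite normrM gtr0_norm//; apply: (@le_trans _ _ (e * (1 + `|t|))).
    by rewrite ler_pM2l// lerDr.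
  by rewrite -ler_pdivlMr ?ltr_wpDr// ge_min lexx orbT.
have [et1 et2] : - 4^-1 <= e * t /\ e * t <= 4^-1 by move: et; rewrite ler_norml => /andP.
have d0 : 0 < 2^-1 + e * t by lra.
exists e => //.
have -> : (1 - 2^-1) *: x + 2^-1 *: y + e *: (u + t *: (x - y)) =
   (1 - (2^-1 - e * t)) *: (x + (e / (2^-1 + e * t)) *: u) + (2^-1 - e * t) *: y.
  by vector_field; move: d0; lra.
apply: cC' => //; first by lra.
apply: (convex_ray cC Cx e00 Ce0).
rewrite ler_pdivrMr// divr_ge0 ?(ltW e_gt0) ?(ltW d0)//=.
have e4 : e <= e0 / 4 by rewrite ge_min lexx.
have : e0 * 4^-1 <= e0 * (2^-1 + e * t) by rewrite ler_pM2l//; lra.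
exact: le_trans.
Qed.

Lemma face_trans C F A : is_face C F -> is_face F A -> is_face C A.
Proof.
move=> fF fA; have [F0 FC cF _] := fF; have [A0 AF cA _] := fA.
apply: is_faceP => //; first exact: subset_trans FC.
move=> x y t Cx Cy t01 At.
have [Fx Fy] := face_segment fF Cx Cy t01 (AF _ At).
exact: face_segment fA Fx Fy t01 At.
Qed.

Lemma face_subset C F A : is_face C A -> A `<=` F -> F `<=` C -> is_face F A.
Proof.
move=> fA AF FC; have [A0 AC cA _] := fA.
apply: is_faceP => // x y t Fx Fy t01 At.
exact: face_segment fA (FC _ Fx) (FC _ Fy) t01 At.
Qed.

Lemma face_min_face C F x : is_face C F -> F x -> F `<=` min_face F x ->
  F = min_face C x.
Proof.
move=> fF Fx Fcore; apply/seteqP; split; last exact: min_face_sub.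
move=> y /Fcore[Fy [e e0 Fe]]; have [_ FC _ _] := fF.
by split; [exact: FC|exists e => //; exact: FC].
Qed.

Lemma face_core C F : is_face C F -> exists2 x, F x & F = min_face C x.
Proof.
move=> fF; have [F0 FC cF _] := fF.
have [x Fx Fcore] := exists_core F0 cF; exists x => //.
exact: face_min_face.
Qed.

Lemma exposed_face (C : set V) (f : {linear V -> R^o}) x : @convex_set R V C ->
  C x -> (forall y, C y -> f y <= f x) -> is_face C (C `&` [set y | f y = f x]).
Proof.
move=> /convex_setP cC Cx fmax; apply: is_faceP.
- by exists x.
- by move=> y [].
- apply/convex_setP => y z t t01 [Cy fy] [Cz fz]; split; first exact: cC.
  by rewrite /= linearD !linearZ fy fz /= -scalerDl subrK scale1r.
move=> y z t Cy Cz /andP[t0 t1] [_ /=].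
rewrite linearD !linearZ /= => ft.
have {}ft : (1 - t) * (f y : R) + t * f z = f x by exact: ft.
have fy := fmax _ Cy; have fz := fmax _ Cz.
suff : f y = f x /\ f z = f x by case.
by split; apply/eqP; rewrite eq_le ?fy ?fz /=; nra.
Qed.

End Faces.

(** * Compact convex sets and supporting hyperplanes *)

Section CompactSets.
Variables (R : realType) (V : vectType R).
Implicit Types (C : set V) (x y v : V) (U : {vspace V}).

Local Notation e := (vbasis {:V}).
Local Notation rVof := (passmx.rVof e).
Local Notation vecof := (passmx.vecof e).

Let rVofK : cancel rVof vecof.
Proof. exact: passmx.rVofK (vbasisP _). Qed.

Let vecofK : cancel vecof rVof.
Proof. exact: passmx.vecofK (vbasisP _). Qed.

(** Compactness of subsets of [V] is read in coordinates, so continuity of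
    functions on [V] is too. *)
Lemma linear_vecof_continuous (f : {linear V -> R^o}) :
  continuous (fun w => f (vecof w) : R).
Proof.
have lf : linear (fun w => f (vecof w) : R^o).
  by move=> t u w; rewrite passmx.vecof_linear linearP.
pose fl := GRing.isLinear.Build _ _ _ _ _ lf.
pose F : {linear 'rV[R]_(\dim {:V}) -> R^o} := HB.pack (fun w => f (vecof w) : R^o) fl.
move=> w; exact: (differentiable_continuous (linear_rV_differentiable F w)).
Qed.

Lemma closed_vecof_vspace U : closed [set w | vecof w \in U].
Proof.
have -> : [set w | vecof w \in U] =
    \bigcap_i (fun w => coord e i (vecof w - projv U (vecof w)) : R) @^-1` [set 0].
  apply/seteqP; split=> w /=.
    by move=> wU i _ /=; rewrite projv_id// subrr linear0.
  move=> w0; suff -> : vecof w = projv U (vecof w) by exact: memv_proj.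
  apply: coord_inj => i; apply/eqP; rewrite -subr_eq0 -linearB; apply/eqP.
  exact: w0.
apply: closed_bigI => i _; apply: closed_comp; last exact: closed_eq.
move=> w _.
have lf : linear (fun v => coord e i (v - projv U v) : R^o).
  move=> t u v; rewrite linearP opprD addrACA -scalerBr.
  exact: linearP.
pose fl := GRing.isLinear.Build _ _ _ _ _ lf.
pose F : {linear V -> R^o} := HB.pack (fun v => coord e i (v - projv U v) : R^o) fl.
exact: (@linear_vecof_continuous F w).
Qed.

Lemma rVof_image C : rVof @` C = vecof @^-1` C.
Proof.
apply/seteqP; split=> [_ [x Cx <-]|w /= Cw]; first by rewrite /= rVofK.
by exists (vecof w).
Qed.

Lemma compact_setI_vspace C U : vect_compact C -> vect_compact (C `&` [set` U]).
Proof.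
rewrite /vect_compact !rVof_image preimage_setI => cC.
exact: compact_closedI cC (@closed_vecof_vspace U).
Qed.

Lemma compact_setI_level C (f : {linear V -> R^o}) (r : R) : vect_compact C ->
  vect_compact (C `&` [set v | f v = r]).
Proof.
rewrite /vect_compact !rVof_image preimage_setI => cC.
apply: compact_closedI cC _.
apply: (@closed_comp _ _ (fun w => f (vecof w) : R) [set r]); last exact: closed_eq.
by move=> w _; exact: (@linear_vecof_continuous f w).
Qed.

Lemma compact_max C (f : V -> R) : C !=set0 -> vect_compact C ->
  continuous (fun w => f (vecof w)) ->
  exists2 x, C x & forall y, C y -> f y <= f x.
Proof.
move=> [x0 Cx0]; rewrite /vect_compact rVof_image => cC cf.
have [||w /set_mem Cw wmax] := compact_EVT_max _ cC (f := fun w => f (vecof w)).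
- by exists (rVof x0); rewrite /= rVofK.
- exact: continuous_subspaceT.
exists (vecof w) => // y Cy; have := wmax (rVof y); rewrite rVofK; apply.
by apply/mem_set; rewrite /= rVofK.
Qed.

Lemma compact_linear_max C (f : {linear V -> R^o}) : C !=set0 ->
  vect_compact C -> exists2 x, C x & forall y, C y -> f y <= f x.
Proof. by move=> C0 cC; apply: compact_max => //; exact: (@linear_vecof_continuous f). Qed.

Variable form : V -> V -> R^o.
Hypothesis formC : forall x y, form x y = form y x.
Hypothesis form_linear : forall x, linear (form x).
Hypothesis form_gt0 : forall x, x != 0 -> 0 < (form x x : R).

HB.instance Definition _ x := GRing.isSemilinear.Build R V R^o _ (form x)
  (GRing.semilinear_linear (@form_linear x)).

Lemma form_sq (t : R) (u v : V) : form (u + t *: v) (u + t *: v) =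
  (form u u : R) + 2 * t * form u v + t ^+ 2 * form v v :> R.
Proof.
have fP (z : V) : form z (u + t *: v) = (form z u : R) + t * form z v.
  by rewrite linearD linearZ.
by rewrite fP (formC _ u) (formC _ v) !fP (formC v u); ring.
Qed.

Let sq_continuous x : continuous (fun w => form (x - vecof w) (x - vecof w) : R).
Proof.
have -> : (fun w => form (x - vecof w) (x - vecof w) : R) =
    (fun w => \sum_i (coord e i (x - vecof w) * form (x - vecof w) e`_i : R)).
  apply/funext => w; rewrite {2}(coord_vbasis (memvf (x - vecof w))) linear_sum.
  by apply: eq_bigr => i _; rewrite linearZ.
have -> : (fun w => \sum_i (coord e i (x - vecof w) * form (x - vecof w) e`_i : R)) =
    \sum_i ((fun w => coord e i (x - vecof w) : R) \*
             (fun w => form (x - vecof w) e`_i : R)).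
  by apply/funext => w; rewrite fct_sumE.
have affine (f : {linear V -> R^o}) w : {for w, continuous (fun w => f (x - vecof w) : R)}.
  have -> : (fun w => f (x - vecof w) : R) =
      (cst (f x : R) \- (fun w => f (vecof w) : R)).
    by apply/funext => u /=; rewrite linearB.
  by apply: continuousB; [exact: cst_continuous|exact: (@linear_vecof_continuous f w)].
move=> w; elim/big_ind: _ => [|f1 f2 c1 c2|i _]; first exact: cst_continuous.
  exact: continuousD.
apply: continuousM; first exact: (affine (coord e i)).
have -> : (fun w => form (x - vecof w) e`_i : R) = (fun w => form e`_i (x - vecof w) : R).
  by apply/funext => u; rewrite formC.
exact: (affine (form e`_i)).
Qed.

(** The point [p] of [C] nearest to [x] exists by compactness, and convexity
    turns its minimality into the first-order inequality. *)
Lemma nearest_point C x : C !=set0 -> @convex_set R V C -> vect_compact C ->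
  exists2 p, C p & forall y, C y -> form (x - p) (y - p) <= (0 : R).
Proof.
move=> C0 /convex_setP cC kC.
have [|p Cp pmin] := @compact_max C (fun y => - form (x - y) (x - y) : R) C0 kC.
  by move=> w; apply: continuousN; exact: sq_continuous.
exists p => // y Cy; rewrite leNgt; apply/negP => b0.
set b := (form (x - p) (y - p) : R) in b0.
set q := (form (y - p) (y - p) : R).
have q_ge0 : 0 <= q.
  have [yp|/form_gt0/ltW//] := eqVneq (y - p) 0.
  by rewrite /q yp linear0.
have sq_expand (t : R) : 0 <= t <= 1 -> 2 * t * b <= t ^+ 2 * q.
  move=> t01; have := pmin _ (cC _ _ _ t01 Cp Cy).
  have -> : x - ((1 - t) *: p + t *: y) = (x - p) + (- t) *: (y - p) by vector_field.
  by rewrite form_sq -/b -/q sqrrN; lra.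
pose t := Num.min 1 (b / (q + 1)).
have q1 : 0 < q + 1 by rewrite ltr_wpDl.
have t0 : 0 < t by rewrite lt_min ltr01 divr_gt0.
have t1 : t <= 1 by rewrite ge_min lexx.
have tq : t * (q + 1) <= b by rewrite -ler_pdivlMr// ge_min lexx orbT.
have := sq_expand t; rewrite (ltW t0) t1 => /(_ isT).
rewrite [t ^+ 2]expr2 -mulrA [2 * _]mulrC -!mulrA ler_pM2l//.
by move: tq b0 t0; nra.
Qed.

Let near_inv (r : R) : 0 < r -> \forall k \near \oo, k.+1%:R^-1 < r :> R.
Proof. by move=> r0; exact: near_infty_natSinv_lt (PosNum r0). Qed.

(** The points [x + eps (x - y)] lie outside [C]; their nearest points in [C] give
    outward normals, which are normalised, and any cluster point of them is a
    suitable [h]. The normals belong to every subspace containing the differences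
    of points of [C]; so does [h], which therefore cannot be orthogonal to all of
    them. *)
Lemma supporting_hyperplane C U x y :
  @convex_set R V C -> vect_compact C -> C `<=` [set` U] -> C x -> C y ->
  (forall t : R, 0 < t -> ~ C (x + t *: (x - y))) ->
  exists h, [/\ h \in U, forall z, C z -> form h z <= (form h x : R) &
    exists2 z, C z & form h z != form h x].
Proof.
move=> cC kC CU Cx Cy xout.
have C0 : C !=set0 by exists x.
pose eps m : R := m.+1%:R^-1.
have eps0 m : 0 < eps m by rewrite invr_gt0 ltr0n.
pose xs m := x + eps m *: (x - y).
have /choice[ps psP] : forall m, exists p, C p /\
    forall z, C z -> form (xs m - p) (z - p) <= (0 : R).
  by move=> m; have [p Cp pP] := nearest_point (xs m) C0 cC kC; exists p.
pose d m := xs m - ps m.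
have d0 m : d m != 0.
  rewrite subr_eq0; apply/eqP => xsps; apply: (xout (eps m)) => //.
  by rewrite -/(xs m) xsps; case: (psP m).
pose nd m : R := `|rVof (d m)|.
have nd0 m : 0 < nd m.
  rewrite normr_gt0; apply: contra (d0 m) => /eqP E.
  by rewrite -[d m]rVofK E passmx.vecof_eq0 //; exact: vbasisP.
pose hs m := (nd m)^-1 *: d m.
have hsP m z : C z -> form (hs m) (z - x) <= eps m * form (hs m) (x - y) :> R.
  move=> Cz; have [Cp pP] := psP m.
  have := pP _ Cz; have := form_gt0 (d0 m); rewrite -/(d m) => d_gt0 dz.
  have xp : form (d m) (xs m - ps m) = form (d m) (x - ps m) + eps m *: form (d m) (x - y).
    by rewrite -linearZ -linearD; congr form; rewrite /xs addrAC.
  have zp : form (d m) (z - ps m) = form (d m) (z - x) + form (d m) (x - ps m).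
    by rewrite -linearD addrA subrK.
  rewrite -!(formC _ (hs m)) !linearZ /= !(formC _ (d m)).
  rewrite mulrCA ler_pM2l ?invr_gt0//.
  by move: d_gt0 dz; rewrite zp {1}/d xp /GRing.scale /=; lra.
pose vs m := rVof (hs m).
have vs1 m : `|vs m| = 1.
  have -> : vs m = (nd m)^-1 *: rVof (d m).
    by apply/rowP => i; rewrite !mxE linearZ.
  by rewrite normrZ gtr0_norm ?invr_gt0// mulVf// gt_eqF.
pose S := [set w : 'rV[R]_(\dim {:V}) | `|w| = 1].
have cS : compact S.
  apply: bounded_closed_compact; first by exists 1; split=> // M M1 w /= ->; exact: ltW.
  apply: (@closed_comp _ _ (fun w => `|w| : R) [set 1]); last exact: closed_eq.
  by move=> w _; exact: norm_continuous.
have [|w [w1 wcl]] := cS (vs @ \oo) _.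
  by exists 0%N => // m _; exact: vs1.
have closedP D : closed D -> (\forall m \near \oo, D (vs m)) -> D w.
  by move=> cD FD; apply: cD => B wB; exact: wcl.
exists (vecof w); split.
- apply: (closedP _ (@closed_vecof_vspace U)); exists 0%N => // m _ /=.
  rewrite rVofK memvZ//; have [Cp _] := psP m.
  have CU' z : C z -> z \in U by exact: CU.
  by rewrite memvB ?memvD ?memvZ ?memvB// CU'.
- move=> z Cz; rewrite -subr_le0 -linearB /= leNgt; apply/negP.
  set q := form _ _ => q0.
  pose r := (form (vecof w) (x - y) : R).
  have qr k : (q : R) <= eps k * r.
    pose f v := form (z - x - eps k *: (x - y)) v.
    have cf : closed [set u | (f (vecof u) : R) <= 0].
      apply: (@closed_comp _ _ (fun u => f (vecof u) : R) [set t | t <= 0]).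
        by move=> u _; exact: (@linear_vecof_continuous (form _) u).
      exact: closed_le.
    have fE v : f v = (form v (z - x) : R) - eps k * form v (x - y).
      by rewrite /f formC linearB linearZ.
    suff : [set u | (f (vecof u) : R) <= 0] w by rewrite /= fE subr_le0.
    apply: closedP => //; exists k => // m /= km.
    rewrite rVofK fE subr_le0; apply: le_trans (hsP m z Cz) _.
    have := hsP m y Cy; rewrite -opprB linearN /= => hxy.
    have : 0 <= (form (hs m) (x - y) : R) * (1 + eps m) by rewrite mulrDr mulr1; lra.
    rewrite pmulr_lge0 ?addr_gt0// => hxy0.
    by rewrite ler_wpM2r// lef_pV2 ?posrE ?ltr0n// ler_nat ltnS.
  have [r0|r0] := leP r 0.
    by have := qr 0%N; rewrite /eps invr1 mul1r; move: q0 r0; lra.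
  have [k _ /(_ k (leqnn k)) /= kq] := near_inv (divr_gt0 q0 r0).
  by have := qr k; rewrite leNgt -ltr_pdivlMr// kq.
- apply: contrapT => hconst.
  have hC z : C z -> form (vecof w) z = form (vecof w) x.
    by move=> Cz; apply/eqP; apply: contrapT => /negP nz; apply: hconst; exists z.
  pose W := lker (linfun (form (vecof w) : V -> R^o)).
  have diffW u v : C u -> C v -> u - v \in W.
    by move=> Cu Cv; rewrite memv_ker lfunE /= linearB /= !hC// subrr.
  have : vecof w \in W.
    apply: (closedP _ (@closed_vecof_vspace W)); exists 0%N => // m _ /=.
    rewrite rVofK memvZ//; have [Cp _] := psP m.
    by rewrite /d /xs addrAC memvD ?memvZ ?diffW.
  rewrite memv_ker lfunE /= => /eqP hw0.
  have : vecof w != 0.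
    rewrite passmx.vecof_eq0; last exact: vbasisP.
    by apply/eqP => w0; move: w1; rewrite w0 /S /= normr0 => /esym/eqP; rewrite oner_eq0.
  by move=> /form_gt0; rewrite hw0 ltxx.
Qed.

End CompactSets.

(** * Slices of an invariant convex body *)

Section Slices.
Variables (R : realType) (n : nat) (G : lieGroupType R n) (g : lieAlgType R).
Variables (theta : 'End(g)) (L : has_lie_algebra G g) (K : set G).
Variable a : {vspace g}.
Hypothesis thetaP : cartan_involution theta.
Hypothesis subK : subgroup K.
Hypothesis compactK : compact K.
Hypothesis lieK : subgroup_lie_algebra L K = [set` cartan_k theta].
Hypothesis maxa : maximal_abelian theta a.
Implicit Types (k l : G) (x y z u w h b : g) (A B C F sigma : set g).
Implicit Types (U : {vspace g}).

Local Notation p := (cartan_p theta).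
Local Notation stab := (pointwise_stabilizer L K).
Local Notation face_of := (face_map L K a).

Let a_p x : x \in a -> x \in p.
Proof. exact: maximal_abelian_p. Qed.

(** A linear form constant on [sigma] is constant on its affine hull. *)
Lemma perpP sigma h : sigma !=set0 ->
  perp a sigma h <->
  h \in a /\ forall x y, sigma x -> sigma y -> killing h x = killing h y.
Proof.
move=> [s0 s0s]; split=> -[ah hs]; split=> //.
  have hull x : sigma x -> aff_hull sigma x.
    move=> sx; exists 1%N, (fun=> x), (fun=> 1); split=> //.
      by rewrite big_ord1.
    by rewrite big_ord1 scale1r.
  move=> x y sx sy; apply/eqP; rewrite -subr_eq0 -linearB; apply/eqP/hs.
  by exists x, y; split=> //; exact: hull.
have hull x : aff_hull sigma x -> killing h x = killing h s0.
  move=> [m [q [t [sq t1 ->]]]]; rewrite linear_sum /=.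
  rewrite -[RHS]mul1r -t1 mulr_suml; apply: eq_bigr => i _.
  by rewrite linearZ /= (hs _ s0 (sq i) s0s).
by move=> _ [x [y [/hull hx /hull hy ->]]]; rewrite linearB /= hx hy subrr.
Qed.

(** The data produced by successive exposed faces: a convex body in the
    centraliser of [B], invariant under the stabiliser of [B]. *)
Definition slice B F :=
  [/\ convex_body F, F `<=` [set` p], forall y, F y -> commutes B y &
      forall k y, stab B k -> F y -> F (Ad L k y)].

(** A weak form of Kostant's convexity theorem. A maximiser commutes with [h] by
    the variational principle, so the stabiliser of [B] and [h] moves it into
    [a], without changing its height. *)
Lemma slice_max B F h : B `<=` [set` a] -> slice B F -> h \in a ->
  exists x, [/\ F x, x \in a & forall y, F y -> killing h y <= killing h x].
Proof.
move=> Ba [[F0 cF kF] Fp FB Finv] ah.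
have [y Fy ymax] := compact_linear_max (killing h) F0 kF.
have py : y \in p by exact: Fp.
have yh : lie y h = 0.
  apply: (@commute_of_max _ _ _ _ _ L K thetaP lieK B y h) => //.
  - exact: a_p.
  - exact: FB.
  - exact: (maximal_abelian_commutes maxa Ba ah).
  - by move=> k kB; apply: ymax; exact: Finv.
have [||k kB ky] := conj_into_abelian thetaP subK compactK lieK maxa (B := B `|` [set h]) _ py.
- by move=> x [/Ba//|->].
- by move=> x [/(FB _ Fy)//|->]; rewrite lieC yh oppr0.
have kB' : stab B k by exact: (stabS (@subsetUl _ _ _) kB).
exists (Ad L k y); split=> //; first exact: Finv.
have -> : killing h (Ad L k y) = killing h y.
  have kh : Ad L k h = h by case: kB => _; apply; right.
  by rewrite -{1}kh killing_Ad.
exact: ymax.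
Qed.

(** A height that is maximal on the slice is maximal on the orbit of its
    maximiser. *)
Lemma slice_commute B F h y : B `<=` [set` a] -> slice B F -> h \in a ->
  F y -> (forall z, F z -> killing h z <= killing h y) -> lie y h = 0.
Proof.
move=> Ba [_ Fp FB Finv] ah Fy ymax.
apply: (@commute_of_max _ _ _ _ _ L K thetaP lieK B y h) => //.
- exact: Fp.
- exact: a_p.
- exact: FB.
- exact: (maximal_abelian_commutes maxa Ba ah).
- by move=> k kB; apply: ymax; exact: Finv.
Qed.

Lemma slice_nonempty B F : B `<=` [set` a] -> slice B F ->
  (F `&` [set` a]) !=set0.
Proof.
move=> Ba sF; have [x [Fx ax _]] := slice_max Ba sF (mem0v a).
by exists x.
Qed.

(** The face map applied to the largest face, the section [P] of the slice itself.
    A height [h] orthogonal to the directions of [P] is constant on [P], hence, by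
    [slice_max] for [h] and [- h], constant on the slice; so every point is a
    maximum and commutes with [h]. The whole slice thus centralises the orthogonal
    of [P] and is swept out of [P] by the stabiliser of that orthogonal. *)
Lemma slice_face_map B F : B `<=` [set` a] -> slice B F ->
  B `<=` perp a (F `&` [set` a]) -> face_of (F `&` [set` a]) = F.
Proof.
move=> Ba sF BP; set P := F `&` [set` a].
have P0 : P !=set0 by exact: slice_nonempty sF.
have [[F0 cF kF] Fp FB Finv] := sF.
apply/seteqP; split=> [_ [k kP [x [Fx ax] <-]]|y Fy].
  by apply: Finv => //; exact: stabS kP.
have Fperp : commutes (perp a P) y.
  move=> h /(perpP _ P0)[ah hP]; rewrite lieC.
  suff hconst z : F z -> killing h z = killing h y.
    by rewrite (slice_commute Ba sF ah Fy) ?oppr0// => z /hconst ->.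
  have [u [Fu au umax]] := slice_max Ba sF ah.
  have [v [Fv av vmax]] := slice_max Ba sF (rpredNr ah).
  have Nh w : killing (- h) w = - killing h w by rewrite killingC linearN killingC.
  have uv : killing h u = killing h v by apply: hP.
  have hz w : F w -> killing h w = killing h u.
    move=> Fw; apply/eqP; rewrite eq_le umax//= uv.
    by rewrite -lerN2 -!Nh vmax.
  by move=> Fz; rewrite !hz.
have [|k kP ky] := conj_into_abelian thetaP subK compactK lieK maxa _ (Fp _ Fy) Fperp.
  by move=> x [].
exists k^-1%g; first exact: (stabV subK kP).
exists (Ad L k y); last exact: AdK.
by split=> //; apply: Finv => //; exact: (stabS BP kP).
Qed.

Lemma is_face_refl C : C !=set0 -> @convex_set R g C -> is_face C C.
Proof. by move=> C0 cC; apply: is_faceP. Qed.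

(** Induction on the codimension of [U] in [a]. A proper face of the section lies
    in a supporting hyperplane; the corresponding exposed face of [F] is a slice
    for [U] enlarged by the normal [h], which is not in [U] because it is not
    constant on the section. *)
Lemma slice_face U F sigma : (U <= a)%VS -> slice [set` U] F ->
  [set` U] `<=` perp a (F `&` [set` a]) -> is_face (F `&` [set` a]) sigma ->
  is_face F (face_of sigma).
Proof.
have [m mU] := ubnP (\dim a - \dim U)%N.
elim: m U F mU => // m IH U F mU Ua sF; set P := F `&` [set` a] => UP fsigma.
have Ua' : [set` U] `<=` [set` a] by move=> x /(subvP Ua).
have [[F0 cF kF] Fp FU Finv] := sF.
have P0 : P !=set0 by exact: slice_nonempty sF.
have cP : @convex_set R g P.
  apply/convex_setP => x y t t01 [Fx ax] [Fy ay]; split.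
    exact: ((convex_setP F).1 cF).
  by rewrite /= memvD ?memvZ.
have [x sx sE] := face_core fsigma.
have [sigma0 sP _ _] := fsigma.
have [Pcore|/existsNP[y /not_implyP[Py ycore]]] :=
    pselect (forall y, P y -> min_face P x y).
  have -> : sigma = P by apply/seteqP; split=> // y /Pcore; rewrite sE.
  by rewrite (slice_face_map Ua' sF UP); exact: is_face_refl.
have [Fx ax] := sP _ sx.
have formP h z : z \in a -> theta_form theta h z = killing h z.
  by move=> az; apply: theta_form_p; exact: a_p.
have [|||||h [ah hmax [z Pz zx]]] := @supporting_hyperplane _ _
  (theta_form theta : g -> g -> R^o) (theta_formC thetaP)
  (@theta_form_linear _ _ theta) (theta_form_gt0 thetaP) P a x y cP.
- exact: compact_setI_vspace.
- by move=> ? [].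
- exact: sP.
- exact: Py.
- by move=> t t0 Pt; apply: ycore; split=> //; exists t.
have {}hmax u : P u -> killing h u <= killing h x.
  by move=> Pu; have := hmax u Pu; rewrite !formP//; case: Pu.
have {}zx : killing h z != killing h x.
  by move: zx; rewrite !formP//; case: Pz.
have hU : h \notin U.
  apply: contra zx => Uh; have [] := (perpP h P0).1 (UP _ Uh).
  by move=> _ hP; apply/eqP/hP => //; exact: sP.
have hmaxF u : F u -> killing h u <= killing h x.
  move=> Fu; have [v [Fv av vmax]] := slice_max Ua' sF ah.
  by apply: le_trans (vmax u Fu) _; exact: hmax.
pose F' := F `&` [set u | killing h u = killing h x].
have fF' : is_face F F' by exact: (exposed_face (f := killing h)).
have [F'0 F'F cF' _] := fF'.
pose U' := (U + <[h]>)%VS.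
have U'a : (U' <= a)%VS by rewrite subv_add Ua -memvE.
have hU' : h \in U' by rewrite memvE addvSr.
have UU' : [set` U] `<=` [set` U'] by move=> u; exact: (subvP (addvSl _ _)).
have sF' : slice [set` U'] F'.
  split.
  - by split=> //; exact: (compact_setI_level (f := killing h)).
  - by move=> u /F'F/Fp.
  - move=> u [Fu hu] _ /memv_addP[b Ub [w /vlineP[t ->] ->]].
    have uh : lie u h = 0 by apply: (slice_commute Ua' sF ah Fu) => v Fv; rewrite hu hmaxF.
    have ub : lie u b = 0 by rewrite lieC (FU _ Fu) ?oppr0.
    by rewrite lieC linearD linearZ /= uh ub scaler0 addr0 oppr0.
  - move=> k u kU' [Fu hu]; split; first by apply: Finv => //; exact: (stabS UU' kU').
    have kh : Ad L k h = h by case: kU' => _; apply.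
    by rewrite /= -{1}kh killing_Ad.
have sF'a : sigma `<=` F' `&` [set` a].
  move=> s ss; have [Fs as_] := sP _ ss; do 2!split=> //=.
  apply/eqP; rewrite eq_le hmaxF//=.
  move: ss; rewrite sE => -[_ [e e0 Pe]].
  have := hmax _ Pe; rewrite linearD linearZ linearB /= gerDl.
  by rewrite /GRing.scale /= pmulr_rle0// subr_le0.
have dimU : (\dim U < \dim U')%N.
  rewrite ltnNge; apply: contra hU => dU; suff -> : U = U' by [].
  by apply/eqP; rewrite eqEdim addvSl.
have dimU' : (\dim a - \dim U' < \dim a - \dim U)%N.
  by apply: ltn_sub2l => //; exact: leq_trans dimU (dimvS U'a).
apply: face_trans fF' _; apply: (IH U' F' _ U'a sF').
- exact: leq_trans dimU' mU.
- move=> v U'v; apply/perpP; first exact: (ex_intro _ x (sF'a _ sx)).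
  split; first exact: (subvP U'a).
  move=> u w [[Fu hu] au] [[Fw hw] aw]; case/memv_addP: U'v => b Ub [c /vlineP[t ->] ->].
  have [_ bP] := (perpP b P0).1 (UP _ Ub).
  rewrite killingC [RHS]killingC !linearD !linearZ /=.
  by rewrite ![killing _ h]killingC hu hw ![killing _ b]killingC (bP u w).
- apply: (face_subset fsigma) => // u [[Fu _] au]; by split.
Qed.

End Slices.

(** * The correspondence between faces *)

Section FaceCorrespondence.
Variables (R : realType) (n : nat) (G : lieGroupType R n) (g : lieAlgType R).
Variables (theta : 'End(g)) (L : has_lie_algebra G g) (K : set G).
Variables (E : set g) (a : {vspace g}).
Hypothesis thetaP : cartan_involution theta.
Hypothesis subK : subgroup K.
Hypothesis compactK : compact K.
Hypothesis lieK : subgroup_lie_algebra L K = [set` cartan_k theta].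
Hypothesis Ep : E `<=` [set` cartan_p theta].
Hypothesis bodyE : convex_body E.
Hypothesis invE : Ad_invariant L K E.
Hypothesis maxa : maximal_abelian theta a.
Implicit Types (k l : G) (x y z : g) (C F sigma : set g) (H : set G).

Local Notation p := (cartan_p theta).
Local Notation stab := (pointwise_stabilizer L K).
Local Notation face_of := (face_map L K a).
Local Notation P := (E `&` [set` a]).
Local Notation N := (normalizer L K a).

Lemma Ad_imageM k l C : Ad L (k * l)%g @` C = Ad L k @` (Ad L l @` C).
Proof.
apply/seteqP; split=> [_ [x Cx <-]|_ [_ [x Cx <-] <-]].
  by rewrite AdM; exists (Ad L l x) => //; exists x.
by exists x => //; rewrite AdM.
Qed.

Lemma Ad_imageVK k C : Ad L k^-1%g @` (Ad L k @` C) = C.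
Proof.
rewrite -Ad_imageM mulVg; apply/seteqP; split=> [_ [x Cx <-]|x Cx].
  by rewrite Ad1.
by exists x => //; rewrite Ad1.
Qed.

Lemma Ad_orbit_eq H k C : subgroup H -> H k ->
  Ad_orbit L H (Ad L k @` C) = Ad_orbit L H C.
Proof.
move=> subH Hk; apply/seteqP; split=> [_ [l Hl <-]|_ [l Hl <-]].
  by exists (l * k)%g; [exact: (subgroupM subH Hl Hk)|exact: Ad_imageM].
exists (l * k^-1)%g; first exact: (subgroupM subH Hl (subgroupV subH Hk)).
apply: etrans (Ad_imageM l k^-1%g _) _.
exact: (congr1 (image^~ (Ad L l)) (Ad_imageVK k C)).
Qed.

Lemma Ad_orbit_refl H C : subgroup H -> Ad_orbit L H C C.
Proof.
move=> subH; exists 1%g; first exact: (subgroup1 subH).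
apply/seteqP; split=> [_ [x Cx <-]|x Cx]; first by rewrite Ad1.
by exists x => //; rewrite Ad1.
Qed.

Lemma min_face_Ad_sub k C x : (forall y, C y -> C (Ad L k y)) ->
  Ad L k @` min_face C x `<=` min_face C (Ad L k x).
Proof.
move=> kC _ [y [Cy [e e0 Ce]] <-]; split; first exact: kC.
by exists e => //; rewrite -linearB -linearZ -linearD; exact: kC.
Qed.

Lemma min_face_Ad k C x : (forall y, C y -> C (Ad L k y)) ->
  (forall y, C y -> C (Ad L k^-1%g y)) ->
  min_face C (Ad L k x) = Ad L k @` min_face C x.
Proof.
move=> kC kVC; apply/seteqP; split; last exact: min_face_Ad_sub.
move=> y Cy; exists (Ad L k^-1%g y); last exact: AdVK.
by rewrite -(AdK L k x); apply: min_face_Ad_sub => //; exists y.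
Qed.

Lemma min_face_Ad_body k x : K k -> min_face E (Ad L k x) = Ad L k @` min_face E x.
Proof.
move=> Kk; apply: min_face_Ad => y Ey; first exact: invE.
by apply: invE => //; exact: subgroupV.
Qed.

Let convexE : @convex_set R g E.
Proof. by case: bodyE. Qed.

Let convexP : @convex_set R g P.
Proof.
apply/convex_setP => x y t t01 [Fx ax] [Fy ay]; split.
  exact: ((convex_setP E).1 convexE).
by rewrite /= memvD ?memvZ.
Qed.

Let slice0 : slice theta L K [set` 0%VS] E.
Proof.
split=> //.
- by move=> y _ b; rewrite /= memv0 => /eqP ->; rewrite lieC linear0 oppr0.
- by move=> k y [Kk _]; exact: invE.
Qed.

Let zero_sub_a : [set` 0%VS] `<=` [set` a].
Proof. by move=> b; rewrite /= memv0 => /eqP ->; exact: mem0v. Qed.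

Let P0 : P !=set0.
Proof.
exact: (slice_nonempty thetaP subK compactK lieK maxa zero_sub_a slice0).
Qed.

Lemma face_map_face sigma : is_face P sigma -> is_face E (face_of sigma).
Proof.
apply: (slice_face thetaP subK compactK lieK maxa (sub0v a) slice0).
move=> b; rewrite /= memv0 => /eqP -> {b}.
apply/(perpP _ _ P0); split; first exact: mem0v.
by move=> x y _ _; rewrite !(killingC 0) !linear0.
Qed.

Lemma face_map_Ad sigma k y : stab (perp a sigma) k -> face_of sigma y ->
  face_of sigma (Ad L k y).
Proof.
move=> kS [l lS [s ss <-]]; exists (k * l)%g; first exact: (stabM subK kS lS).
by exists s => //; exact: AdM.
Qed.

Lemma face_map_incl sigma : sigma `<=` face_of sigma.
Proof.
move=> x sx; exists 1%g; first exact: stab1.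
by exists x => //; exact: Ad1.
Qed.

(** A relatively interior point of [face_of sigma] can be moved by the stabiliser
    into [sigma], hence into every face of [E] that contains a relatively
    interior point [x] of [sigma]. *)
Lemma face_map_min_face x : P x -> face_of (min_face P x) = min_face E x.
Proof.
move=> Px; set sigma := min_face P x; have [Ex ax] := Px.
have fF := face_map_face (min_face_is_face convexP Px); rewrite -/sigma in fF.
apply/seteqP; split; last first.
  by apply: min_face_sub fF _; apply: face_map_incl; exact: min_face_refl.
have [F0 FE cF _] := fF.
have [z Fz zcore] := exists_core F0 cF.
have [k kS [z' sz' zE]] := Fz.
have fM := min_face_is_face convexE Ex.
have Mz' : min_face E x z'.
  have [[Ez' _] [e e0 [Ce _]]] := sz'; by split=> //; exists e.
move=> y Fy; apply: (min_face_sub fM Mz').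
have Kk : K k by case: kS.
have : min_face E (Ad L k z') (Ad L k y).
  rewrite zE; have [Fky [e e0 Fe]] := zcore _ (face_map_Ad kS Fy).
  by split; [exact: FE|exists e => //; exact: FE].
rewrite min_face_Ad_body// => -[u uE] /(congr1 (Ad L k^-1%g)).
by rewrite !AdK => <-.
Qed.

Lemma normalizer_K k : N k -> K k.
Proof. by case. Qed.

Lemma normalizer_subgroup : subgroup N.
Proof.
split.
  split; first exact: (subgroup1 subK).
  apply/seteqP; split=> [_ [x ax <-]|x ax]; first by rewrite Ad1.
  by exists x => //; rewrite Ad1.
move=> k l [Kk ka] [Kl la]; split; first exact: (subgroupM subK Kk (subgroupV subK Kl)).
apply: etrans (Ad_imageM k l^-1%g _) _.
apply: etrans ka; congr image; rewrite -[in LHS]la; exact: Ad_imageVK.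
Qed.

Lemma normalizer_section k y : N k -> P y -> P (Ad L k y).
Proof.
move=> [Kk ka] [Ey ay]; split; first exact: invE.
by rewrite -ka; exists y.
Qed.

Lemma min_face_Ad_section k x : N k ->
  min_face P (Ad L k x) = Ad L k @` min_face P x.
Proof.
move=> Nk; apply: min_face_Ad => y; first exact: normalizer_section.
by apply: normalizer_section; exact: (subgroupV normalizer_subgroup Nk).
Qed.

(** Both sides are smallest faces of [E], at [Ad k x] with [x] a relatively
    interior point of [sigma]. *)
Lemma face_map_equivariant k sigma : N k -> is_face P sigma ->
  face_of (Ad L k @` sigma) = Ad L k @` face_of sigma.
Proof.
move=> Nk /face_core[x sx sE].
have Px : P x by move: sx; rewrite sE => -[].
rewrite sE -min_face_Ad_section// !face_map_min_face//.
  exact: (min_face_Ad_body _ (normalizer_K Nk)).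
exact: normalizer_section.
Qed.

(** A relatively interior point of the face is moved into [a]. *)
Lemma face_map_surjective F : is_face E F -> exists sigma k,
  [/\ is_face P sigma, K k & F = Ad L k @` face_of sigma].
Proof.
move=> fF; have [x Fx FE] := face_core fF; have [_ FsubE _ _] := fF.
have Ex : E x by exact: FsubE.
have [||k [Kk _] ka] := conj_into_abelian thetaP subK compactK lieK maxa
  (B := set0) _ (Ep Ex).
- by [].
- by [].
have Px : P (Ad L k x) by split=> //; exact: invE.
exists (min_face P (Ad L k x)), k^-1%g; split.
- exact: min_face_is_face.
- exact: (subgroupV subK Kk).
- by rewrite face_map_min_face// min_face_Ad_body// Ad_imageVK.
Qed.

(** Two points of the maximal abelian subspace that are conjugate under [K] are
    conjugate under the normalizer: [a] and its image are maximal abelian in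
    the centraliser of the point. *)
Lemma conj_normalizer k x : K k -> x \in a -> Ad L k x \in a ->
  exists2 l, N l & Ad L l x = Ad L k x.
Proof.
move=> Kk ax akx; set x' := Ad L k x.
pose ys := [seq Ad L k b | b <- vbasis a].
have ya b : b \in vbasis a -> b \in a by exact: vbasis_mem.
have [||||l [Kl lx'] lys] := @conj_seq_into_abelian _ _ _ _ _ L K a thetaP subK compactK
  lieK maxa ys [set x'].
- by move=> _ ->.
- move=> _ /mapP[b /ya ab ->]; apply: (Ad_cartan_p thetaP subK lieK) => //.
  exact: (maximal_abelian_p maxa).
- move=> _ /mapP[b /ya ab ->] _ ->.
  by rewrite /x' -Ad_lie (maximal_abelian_lie maxa)// linear0.
- move=> _ _ /mapP[b /ya ab ->] /mapP[c /ya ac ->].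
  by rewrite -Ad_lie (maximal_abelian_lie maxa)// linear0.
exists (l * k)%g; last by rewrite AdM lx'.
split; first exact: (subgroupM subK Kl Kk).
have sub y : y \in a -> Ad L (l * k)%g y \in a.
  move=> ay; rewrite (coord_vbasis ay) linear_sum rpred_sum// => i _.
  rewrite linearZ /= AdM memvZ// lys//; apply: map_f.
  by rewrite mem_nth// size_tuple.
pose f := linfun (Ad L (l * k)%g).
have fa : (f @: a)%VS = a.
  apply/eqP; rewrite eqEdim limg_dim_eq ?leqnn ?andbT.
    by apply/subvP => _ /memv_imgP[y ay ->]; rewrite lfunE; exact: sub.
  apply/eqP; rewrite -subv0; apply/subvP => y /memv_capP[_].
  rewrite memv_ker lfunE memv0 /= => /eqP fy.
  by rewrite -(AdK L (l * k)%g y) fy linear0.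
apply/seteqP; split=> [_ [y ay <-]|y /= ay]; first exact: sub.
have /memv_imgP[z az ->] : y \in (f @: a)%VS by rewrite fa.
by exists z => //; rewrite lfunE.
Qed.

(** Two steps: the stabiliser attached to [sigma1] moves the image of a relatively
    interior point of [sigma2] to a point [x1] of [sigma1] without changing the
    face, and [conj_normalizer] then replaces the conjugation by an element of
    the normalizer, which also matches the faces of the section. *)
Lemma face_map_injective sigma1 sigma2 k : is_face P sigma1 -> is_face P sigma2 ->
  K k -> face_of sigma1 = Ad L k @` face_of sigma2 ->
  exists2 l, N l & sigma1 = Ad L l @` sigma2.
Proof.
move=> f1 f2 Kk E12.
have [x2 s2x2 s2E] := face_core f2.
have Px2 : P x2 by move: s2x2; rewrite s2E => -[].
have F2E : face_of sigma2 = min_face E x2 by rewrite s2E face_map_min_face.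
have F1E : face_of sigma1 = min_face E (Ad L k x2).
  by rewrite E12 F2E -min_face_Ad_body.
have [k1 k1S [x1 s1x1 x1E]] : face_of sigma1 (Ad L k x2).
  by rewrite F1E; apply: min_face_refl; apply: invE => //; case: Px2.
have Kk1 : K k1 by case: k1S.
have [_ s1P _ _] := f1.
have Px1 := s1P _ s1x1.
have F1E' : min_face E x1 = face_of sigma1.
  rewrite -(AdK L k1 x1) x1E min_face_Ad_body; last exact: (subgroupV subK Kk1).
  rewrite -F1E; apply/seteqP; split=> [_ [y Fy <-]|y Fy].
    exact: (face_map_Ad (stabV subK k1S) Fy).
  by exists (Ad L k1 y); [exact: (face_map_Ad k1S Fy)|exact: AdK].
have s1E : sigma1 = min_face P x1.
  apply/seteqP; split; last exact: min_face_sub.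
  move=> y s1y; have [Ey ay] := s1P _ s1y.
  have [_ [e e0 Ee]] : min_face E x1 y by rewrite F1E'; exact: face_map_incl.
  split=> //; exists e => //; split=> //=.
  by have [_ ax1] := Px1; rewrite memvD// memvZ// memvB.
have x12 : Ad L (k1^-1 * k)%g x2 = x1 by rewrite AdM -x1E AdK.
have [|||l Nl lx2] := @conj_normalizer (k1^-1 * k)%g x2 _ _ _.
- exact: (subgroupM subK (subgroupV subK Kk1) Kk).
- by case: Px2.
- by rewrite x12; case: Px1.
exists l; first exact: Nl.
by rewrite s2E -(min_face_Ad_section x2 Nl) lx2 x12.
Qed.

End FaceCorrespondence.

Theorem theorem0p1 (R : realType) (g : lieAlgType R) (theta : 'End(g))
    (n : nat) (G : lieGroupType R n) (L : has_lie_algebra G g) (K : set G)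
    (E : set g) (a : {vspace g}) :
  semisimple g ->
  cartan_involution theta ->
  connected [set: G] ->
  maximal_compact_subgroup K ->
  subgroup_lie_algebra L K = [set` cartan_k theta] ->
  E `<=` [set` cartan_p theta] ->
  convex_body E ->
  Ad_invariant L K E ->
  maximal_abelian theta a ->
  let P := E `&` [set` a] in
  let N := normalizer L K a in
  (forall sigma, is_face P sigma -> is_face E (face_map L K a sigma)) /\
  exists2 Phi : set (set g) -> set (set g),
    set_bij (orbit_space L N (faces P)) (orbit_space L K (faces E)) Phi &
    forall sigma, is_face P sigma ->
      Phi (Ad_orbit L N sigma) = Ad_orbit L K (face_map L K a sigma).
Proof.
move=> _ thetaP _ [subK compactK _] lieK Ep bodyE invE maxa P N.
have fmapP := face_map_face thetaP subK compactK lieK Ep bodyE invE maxa.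
split; first exact: fmapP.
have subN : subgroup N by exact: normalizer_subgroup.
have /choice[rep repP] : forall O, exists sigma, orbit_space L N (faces P) O ->
    is_face P sigma /\ Ad_orbit L N sigma = O.
  move=> O; have [[sigma fs <-]|nO] := pselect (orbit_space L N (faces P) O).
    by exists sigma.
  by exists set0.
pose Phi O := Ad_orbit L K (face_map L K a (rep O)).
have PhiE sigma : is_face P sigma ->
    Phi (Ad_orbit L N sigma) = Ad_orbit L K (face_map L K a sigma).
  move=> fs; have [|frep repE] := repP (Ad_orbit L N sigma).
    by exists sigma.
  have [k Nk kE] : Ad_orbit L N (rep (Ad_orbit L N sigma)) sigma.
    by rewrite repE; exact: Ad_orbit_refl.
  rewrite /Phi -[in RHS]kE.
  rewrite (face_map_equivariant thetaP subK compactK lieK Ep bodyE invE maxa Nk frep).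
  by rewrite (Ad_orbit_eq _ _ subK (normalizer_K Nk)).
exists Phi; last exact: PhiE.
split.
- move=> _ [sigma fs <-]; exists (face_map L K a sigma); first exact: fmapP.
  by rewrite PhiE.
- move=> _ _ /set_mem[s1 f1 <-] /set_mem[s2 f2 <-]; rewrite !PhiE// => E12.
  have [k Kk kE] : Ad_orbit L K (face_map L K a s2) (face_map L K a s1).
    by rewrite -E12; exact: Ad_orbit_refl.
  have [l Nl ->] := face_map_injective thetaP subK compactK lieK Ep bodyE invE maxa
    f1 f2 Kk (esym kE).
  exact: Ad_orbit_eq.
- move=> _ [F fF <-].
  have [sigma [k [fs Kk ->]]] := face_map_surjective thetaP subK compactK lieK Ep
    bodyE invE maxa fF.
  exists (Ad_orbit L N sigma); first by exists sigma.
  by rewrite PhiE// Ad_orbit_eq.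
Qed.
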